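(* Let $\Omega\subseteq\mathbb{R}^n$ be a nonempty open set, $s\in\mathbb{R}$, $1<p<\infty$, and let $(s,p,\Omega)$ be an interior smooth multiplication triple. If $A\subseteq C_c^\infty(\Omega)$ is an admissible family of functions, then: (1) $W^{s,p}_{loc}(\Omega)=\{u\in D'(\Omega):\ \varphi u\in W^{s,p}(\Omega)\ \text{for all }\varphi\in A\}$. (2) The collection $\{|\cdot|_\varphi:\varphi\in A\}$ is a separating family of seminorms on $W^{s,p}_{loc}(\Omega)$. (3) The natural topology induced by the separating family of seminorms $\{|\cdot|_\varphi:\varphi\in A\}$ is the same as the topology of $W^{s,p}_{loc}(\Omega)$.
   Context: All functions are real-valued. $C_c^\infty(\Omega)$ is the set of smooth functions with compact support in $\Omega$; $D'(\Omega)$ is the space of distributions on $\Omega$. Let $\frac1p+\frac1{p'}=1$. Sobolev-Slobodeckij spaces: for $k\in\mathbb{N}_0$, $W^{k,p}(\Omega)=\{u\in L^p(\Omega):\|u\|_{W^{k,p}(\Omega)}:=\sum_{|\nu|\le k}\|\partial^\nu u\|_{L^p(\Omega)}<\infty\}$; for $0<\theta<1$, $|u|_{W^{\theta,p}(\Omega)}:=\big(\iint_{\Omega\times\Omega}\frac{|u(x)-u(y)|^p}{|x-y|^{n+\theta p}}dx\,dy\big)^{1/p}$; for $s=k+\theta$ with $k\in\mathbb{N}_0$, $0<\theta<1$, $W^{s,p}(\Omega)=\{u\in W^{k,p}(\Omega):\|u\|_{W^{s,p}(\Omega)}:=\|u\|_{W^{k,p}(\Omega)}+\sum_{|\nu|=k}|\partial^\nu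 u|_{W^{\theta,p}(\Omega)}<\infty\}$. $W^{s,p}_0(\Omega)$ is the closure of $C_c^\infty(\Omega)$ in $W^{s,p}(\Omega)$. For $s<0$, $W^{s,p}(\Omega)=(W^{-s,p'}_0(\Omega))^*$ with the dual norm, viewed as a subspace of $D'(\Omega)$ by restricting functionals to $C_c^\infty(\Omega)$. For compact $K\subseteq\Omega$, $W^{s,p}_K(\Omega)=\{u\in W^{s,p}(\Omega):\mathrm{supp}\,u\subseteq K\}$ with the norm of $W^{s,p}(\Omega)$. $W^{s,p}_{loc}(\Omega)=\{u\in D'(\Omega):\varphi u\in W^{s,p}(\Omega)\ \forall\varphi\in C_c^\infty(\Omega)\}$, equipped with the natural topology induced by the seminorms $|u|_\varphi:=\|\varphi u\|_{W^{s,p}(\Omega)}$, $\varphi\in C_c^\infty(\Omega)$. A family $\mathcal{P}$ of seminorms on a vector space $X$ is separating if for every $x\ne0$ some $q\in\mathcal{P}$ has $q(x)\ne0$; the natural topology it induces is the smallest translation invariant topology on $X$ making every $q\in\mathcal{P}$ continuous. $(s,p,\Omega)$ is an interior smooth multiplication triple if for all $\varphi\in C_c^\infty(\Omega)$ and compact $K\subseteq\Omega$ the map $u\mapsto\varphi u$ is well-defined and bounded from $W^{s,p}_K(\Omega)$ to $W^{s,p}_K(\Omega)$. A subset $A\subseteq C_c^\infty(\Omega)$ is an admissible family of functions if for every $x\in\Omega$ there is $\varphi\in A$ with $\varphi\ge0$ and $\varphi(x)\ne0$. *)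

(* Defs.v *)
(* Real analysis over an arbitrary MathComp-Analysis [R : realType]; R^n is
   ['rV[R]_n]. *)
From HB Require Import structures.
From mathcomp Require Import all_boot all_order all_algebra.
From mathcomp Require Import all_classical all_reals all_analysis.

Set Implicit Arguments.
Unset Strict Implicit.
Unset Printing Implicit Defensive.

Import Order.TTheory GRing.Theory Num.Theory.
Import numFieldNormedType.Exports.

Local Open Scope classical_set_scope.
Local Open Scope ring_scope.

(* The sigma-algebra of ['rV[R]_n] is generated by the coordinate maps, as the
   library does for tuples; it is the Borel sigma-algebra of R^n. *)
Section measurable_rV.
Context {R : realType} (n : nat).

Definition rV_coord (i : 'I_n) (x : 'rV[R]_n) : measurableTypeR R := x ord0 i.

Let rV_set0 : g_sigma_preimage rV_coord set0.
Proof. exact: sigma_algebra0. Qed.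

Let rV_setC A : g_sigma_preimage rV_coord A -> g_sigma_preimage rV_coord (~` A).
Proof. exact: sigma_algebraC. Qed.

Let rV_bigcup (F : (set 'rV[R]_n)^nat) :
  (forall i, g_sigma_preimage rV_coord (F i)) ->
  g_sigma_preimage rV_coord (\bigcup_i (F i)).
Proof. exact: sigma_algebra_bigcup. Qed.

HB.instance Definition _ := @isMeasurable.Build default_measure_display
  'rV[R]_n (g_sigma_preimage rV_coord) rV_set0 rV_setC rV_bigcup.

End measurable_rV.

Section lebesgue_rV.
Context {R : realType}.

Lemma measurable_rV_coord n (i : 'I_n) :
  measurable_fun [set: 'rV[R]_n] (@rV_coord R n i).
Proof.
move=> _ Y mY; rewrite setTI; apply: sub_sigma_algebra => /=.
rewrite -bigcup_seq/=; exists i => /=; first by rewrite mem_index_enum.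
by exists Y => //; rewrite setTI.
Qed.

Lemma measurable_fun_rV d (T : measurableType d) n (f : T -> 'rV[R]_n) :
  (forall i, measurable_fun [set: T] (@rV_coord R n i \o f)) ->
  measurable_fun [set: T] f.
Proof.
move=> mf; move=> _ Y mY; rewrite setTI.
have : image_set_system [set: T] f measurable Y; last first.
  by rewrite /image_set_system/= setTI.
move: Y mY; apply: smallest_sub.
  by apply: sigma_algebra_image; exact: sigma_algebra_measurable.
move=> Y; rewrite -bigcup_seq => -[i _ [B mB <-]].
by rewrite /image_set_system/= !setTI; have := mf i measurableT _ mB;
  rewrite setTI.
Qed.

Definition rV_cons n (z : measurableTypeR R * 'rV[R]_n) : 'rV[R]_n.+1 :=
  \row_i oapp (z.2 ord0) z.1 (unlift ord0 i).

Definition rV_uncons n (x : 'rV[R]_n.+1) : measurableTypeR R * 'rV[R]_n :=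
  (x ord0 ord0, \row_i x ord0 (lift ord0 i)).

Lemma rV_cons0 n (z : measurableTypeR R * 'rV[R]_n) :
  rV_cons z ord0 ord0 = z.1.
Proof. by rewrite mxE unlift_none. Qed.

Lemma rV_consS n (z : measurableTypeR R * 'rV[R]_n) i :
  rV_cons z ord0 (lift ord0 i) = z.2 ord0 i.
Proof. by rewrite mxE liftK. Qed.

Lemma rV_consK n : cancel (@rV_cons n) (@rV_uncons n).
Proof.
move=> z; rewrite /rV_uncons rV_cons0; case: z => a x /=; congr pair.
by apply/rowP => i; rewrite mxE rV_consS.
Qed.

Lemma measurable_rV_cons n : measurable_fun setT (@rV_cons n).
Proof.
apply: measurable_fun_rV => i.
have [j ->|->] := unliftP ord0 i.
  rewrite (_ : _ \o _ = @rV_coord R n j \o snd); last first.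
    by apply/funext => z /=; rewrite /rV_coord rV_consS.
  by apply: measurableT_comp => //; exact: measurable_rV_coord.
rewrite (_ : _ \o _ = fst) //.
by apply/funext => z /=; rewrite /rV_coord rV_cons0.
Qed.

Lemma measurable_rV_uncons n : measurable_fun setT (@rV_uncons n).
Proof.
apply: measurable_fun_pair; first exact: (measurable_rV_coord ord0).
apply: measurable_fun_rV => i.
rewrite (_ : _ \o _ = rV_coord (lift ord0 i)); last first.
  by apply/funext => x /=; rewrite /rV_coord mxE.
exact: measurable_rV_coord.
Qed.

Section lebesgue_rV_step.
Variables (n : nat) (mu : {sigma_finite_measure set 'rV[R]_n -> \bar R}).

Definition leb_step : set 'rV[R]_n.+1 -> \bar R :=
  pushforward ((@lebesgue_measure R) \x mu)%E (@rV_cons n).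

Let mcons := @measurable_rV_cons n.

Let leb_step0 : leb_step set0 = 0%E.
Proof. exact: measure0. Qed.

Let leb_step_ge0 A : (0 <= leb_step A)%E.
Proof. exact: measure_ge0. Qed.

Let leb_step_sigma_additive : semi_sigma_additive leb_step.
Proof. exact: measure_semi_sigma_additive. Qed.

HB.instance Definition _ := isMeasure.Build _ _ _ leb_step
  leb_step0 leb_step_ge0 leb_step_sigma_additive.

Let leb_step_sigma_finite : sigma_finite setT leb_step.
Proof.
have /sigma_finiteP[F [FT ndF Foo]] := sigma_finiteT (@lebesgue_measure R).
have /sigma_finiteP[G [GT ndG Goo]] := sigma_finiteT mu.
exists (fun k => @rV_uncons n @^-1` (F k `*` G k)).
  apply/seteqP; split => // x _; rewrite -preimage_bigcup /=.
  have [i _ Fi] : (\bigcup_i F i) (rV_uncons x).1 by rewrite -FT.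
  have [j _ Gj] : (\bigcup_i G i) (rV_uncons x).2 by rewrite -GT.
  exists (maxn i j) => //; split => /=.
  - by move: Fi; exact/subsetPset/ndF/leq_maxl.
  - by move: Gj; exact/subsetPset/ndG/leq_maxr.
move=> k; have [mF Fkoo] := Foo k; have [mG Gkoo] := Goo k; split.
  rewrite -[X in measurable X]setTI; apply: measurable_rV_uncons => //.
  exact: measurableX.
rewrite /leb_step /pushforward -comp_preimage.
rewrite (_ : _ \o _ = id); last by apply/funext => z /=; rewrite rV_consK.
by rewrite preimage_id product_measure1E// lte_mul_pinfty// ge0_fin_numE.
Qed.

HB.instance Definition _ := @Measure_isSigmaFinite.Build _ _ _ leb_step
  leb_step_sigma_finite.

End lebesgue_rV_step.

Fixpoint leb (n : nat) : {sigma_finite_measure set 'rV[R]_n -> \bar R} :=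
  match n with
  | 0 => \d_(0 : 'rV[R]_0)
  | n'.+1 => leb_step (leb n')
  end.

End lebesgue_rV.

Section smooth_functions.
Context {R : realType} {n : nat}.
Local Notation E := 'rV[R]_n.
Implicit Types (f g : E -> R) (l : seq 'I_n).

Definition partial (i : 'I_n) f : E -> R := 'D_(delta_mx ord0 i) f.

Definition partials l f : E -> R := foldr partial f l.

Definition smooth f := forall l, continuous (partials l f) /\
  forall x i, derivable (partials l f) x (delta_mx ord0 i).

Definition supp f : set E := closure [set x | f x != 0].

Lemma smooth_ind (S : set (E -> R)) :
  (forall g, S g -> continuous g) ->
  (forall g x i, S g -> derivable g x (delta_mx ord0 i)) ->
  (forall g i, S g -> S (partial i g)) ->
  forall f, S f -> smooth f.
Proof.
move=> Sc Sd Sp f Sf l.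
suff Sl : S (partials l f) by split=> [|x i]; [exact: Sc|exact: Sd].
by elim: l => //= i l; exact: Sp.
Qed.

Lemma partials_cat l1 l2 f : partials (l1 ++ l2) f = partials l1 (partials l2 f).
Proof. exact: foldr_cat. Qed.

Lemma smooth_partials l f : smooth f -> smooth (partials l f).
Proof. by move=> sf l'; rewrite -partials_cat; exact: sf. Qed.

Lemma smooth_cst (c : R) : smooth (cst c).
Proof.
apply: (@smooth_ind [set g | exists c, g = cst c]); last by exists c.
- by move=> _ [a ->]; exact: cst_continuous.
- by move=> _ x i [a ->]; exact: derivable_cst.
- by move=> _ i [a ->]; exists 0; apply/funext => x; exact: derive_cst.
Qed.

Inductive smooth_alg : (E -> R) -> Prop :=
| smooth_algS f : smooth f -> smooth_alg f
| smooth_algD f g : smooth_alg f -> smooth_alg g -> smooth_alg (f + g)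
| smooth_algM f g : smooth_alg f -> smooth_alg g -> smooth_alg (f * g).

Lemma smooth_alg_derivable f x i :
  smooth_alg f -> derivable f x (delta_mx ord0 i).
Proof.
elim=> {}f => [sf|g _ df _ dg|g _ df _ dg].
- exact: (sf [::]).2.
- exact: derivableD.
- exact: derivableM.
Qed.

Lemma smooth_alg_smooth f : smooth_alg f -> smooth f.
Proof.
apply: smooth_ind => {f} [f|f x i|f i].
- elim=> {}f => [sf|g _ cf _ cg|g _ cf _ cg].
  + exact: (sf [::]).1.
  + by move=> x; apply: continuousD; [exact: cf|exact: cg].
  + by move=> x; apply: continuousM; [exact: cf|exact: cg].
- exact: smooth_alg_derivable.
- elim=> {}f => [sf|g af df ag dg|g af df ag dg].
  + by apply: smooth_algS; exact: (smooth_partials [:: i]).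
  + rewrite (_ : partial i _ = partial i f + partial i g).
      exact: smooth_algD.
    by apply/funext => x; apply: deriveD; exact: smooth_alg_derivable.
  + rewrite (_ : partial i _ = f * partial i g + g * partial i f).
      by apply: smooth_algD; exact: smooth_algM.
    by apply/funext => x; apply: deriveM; exact: smooth_alg_derivable.
Qed.

Lemma smoothD f g : smooth f -> smooth g -> smooth (f + g).
Proof.
by move=> sf sg; apply: smooth_alg_smooth; apply: smooth_algD; exact: smooth_algS.
Qed.

Lemma smoothM f g : smooth f -> smooth g -> smooth (f * g).
Proof.
by move=> sf sg; apply: smooth_alg_smooth; apply: smooth_algM; exact: smooth_algS.
Qed.

Lemma partial_supp f i : supp (partial i f) `<=` supp f.
Proof.
have -> : supp f = closure (supp f) by exact/closure_id/closed_closure.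
apply: closure_subset => x /= fx; apply: contrapT => nx.
have nfx : \forall y \near x, f y = cst 0 y.
  have : nbhs x (~` supp f).
    by apply: open_nbhs_nbhs; split=> //; exact/closed_openC/closed_closure.
  apply: filterS => y /= ny; apply/eqP; apply: contrapT => /negP fy.
  by apply: ny; exact: subset_closure.
by move: fx; rewrite /partial (near_eq_derive _ nfx) derive_cst eqxx.
Qed.

Lemma suppD f g : supp (f + g) `<=` supp f `|` supp g.
Proof.
rewrite -closureU; apply: closure_subset => x /= fgx.
have [fx0|] := eqVneq (f x) 0; [right|by left].
by apply: contra_neq fgx => gx0; rewrite fctE fx0 gx0 addr0.
Qed.

Lemma suppMl f g : supp (f * g) `<=` supp f.
Proof.
apply: closure_subset => x /=; apply: contra_neq => fx0.
by rewrite fctE fx0 mul0r.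
Qed.

Lemma suppMr f g : supp (f * g) `<=` supp g.
Proof.
apply: closure_subset => x /=; apply: contra_neq => gx0.
by rewrite fctE gx0 mulr0.
Qed.

Lemma supp0 : supp (0 : E -> R) = set0.
Proof.
rewrite /supp (_ : [set _ | _] = set0) ?closure0//.
by apply/seteqP; split => // x /=; rewrite eqxx.
Qed.

End smooth_functions.

Section test_functions.
Context {R : realType} {n : nat}.
Local Notation E := 'rV[R]_n.
Variable Omega : set E.

Definition Cc_smooth : {pred (E -> R^o)} := [pred f : E -> R^o |
  `[< [/\ smooth (f : E -> R), compact (supp f) & supp f `<=` Omega] >]].

Lemma Cc_smoothP (f : E -> R^o) :
  reflect [/\ smooth (f : E -> R), compact (supp f) & supp f `<=` Omega]
    (f \in Cc_smooth).
Proof. exact: asboolP. Qed.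

Lemma Cc_smooth_sub (f g : E -> R) : smooth g -> supp g `<=` supp f ->
  f \in Cc_smooth -> g \in Cc_smooth.
Proof.
move=> sg gf /Cc_smoothP[sf cf fO]; apply/Cc_smoothP; split=> //.
- by apply: subclosed_compact cf gf; exact: closed_closure.
- exact: subset_trans fO.
Qed.

Lemma Cc_smooth_submod_closed : submod_closed Cc_smooth.
Proof.
split.
  apply/Cc_smoothP; rewrite supp0; split=> //; last exact: compact0.
  exact: smooth_cst.
move=> a f g fC gC.
have : (cst a : E -> R) * f \in Cc_smooth.
  apply: Cc_smooth_sub (fC); last exact: suppMr.
  by apply: smoothM; [exact: smooth_cst|by case/Cc_smoothP: fC].
move=> /Cc_smoothP[saf caf afO]; move: gC => /Cc_smoothP[sg cg gO].
apply/Cc_smoothP; split.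
- exact: smoothD.
- apply: subclosed_compact (compactU caf cg) (@suppD _ _ _ _).
  exact: closed_closure.
- by apply: (subset_trans (@suppD _ _ _ _)) => x [/afO|/gO].
Qed.

HB.instance Definition _ := GRing.isSubmodClosed.Build R (E -> R^o) Cc_smooth
  Cc_smooth_submod_closed.

Record testfun := TestFun {
  testfun_val :> E -> R^o ;
  testfun_in : testfun_val \in Cc_smooth }.

HB.instance Definition _ := [isSub for testfun_val].
HB.instance Definition _ := [Choice of testfun by <:].
HB.instance Definition _ := [SubChoice_isSubLmodule of testfun by <:].

Lemma testfun_smooth (phi : testfun) : smooth (phi : E -> R).
Proof. by have /Cc_smoothP[] := testfun_in phi. Qed.

Lemma mul_testfun_in (phi psi : testfun) :
  (phi : E -> R) * (psi : E -> R) \in Cc_smooth.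
Proof.
apply: Cc_smooth_sub (testfun_in phi); last exact: suppMl.
by apply: smoothM; exact: testfun_smooth.
Qed.

Definition mul_testfun phi psi := TestFun (mul_testfun_in phi psi).

Lemma partials_supp l (f : E -> R) : supp (partials l f) `<=` supp f.
Proof. by elim: l => //= i l; apply: subset_trans; exact: partial_supp. Qed.

Lemma partials_testfun_in l (phi : testfun) :
  partials l (phi : E -> R) \in Cc_smooth.
Proof.
apply: Cc_smooth_sub (testfun_in phi); last exact: partials_supp.
by apply: smooth_partials; exact: testfun_smooth.
Qed.

Definition partials_testfun l phi := TestFun (partials_testfun_in l phi).

End test_functions.

Section multi_indices.
Context {n : nat}.

(* Multi-indices with entries at most [k]; those of order at most [k] are
   selected in sums by [ord nu <= k]. *)
Definition midx k := {ffun 'I_n -> 'I_k.+1}.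

Definition ord k (nu : midx k) : nat := (\sum_i nu i)%N.

Definition midx_seq k (nu : midx k) : seq 'I_n :=
  flatten [seq nseq (nu i) i | i <- enum 'I_n].

End multi_indices.
Arguments midx : clear implicits.

Section distributions.
Context {R : realType} {n : nat}.
Local Notation E := 'rV[R]_n.
Variable Omega : set E.

Definition functional := testfun Omega -> R^o.

(* Continuity of a linear functional on C_c^oo(Omega) is expressed by the usual
   seminorm estimates on compact subsets. *)
Definition distributions : set functional := [set u | linear u /\
  forall K : set E, compact K -> K `<=` Omega ->
    exists (C : R) (N : nat), forall phi : testfun Omega, supp phi `<=` K ->
      `|u phi| <= C * \sum_(nu : midx n N | (ord nu <= N)%N)
                        sup (range (fun x => `|partials (midx_seq nu) phi x|))].

Definition dmul (phi : testfun Omega) (u : functional) : functional :=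
  fun psi => u (mul_testfun phi psi).

Definition dpartial k (nu : midx n k) (u : functional) : functional :=
  fun psi => (-1) ^+ ord nu * u (partials_testfun (midx_seq nu) psi).

Definition dist_of (f : E -> R) : functional :=
  fun psi => (\int[leb n]_(x in Omega) (f x * psi x))%R.

Definition dsupp (u : functional) : set E :=
  [set x | Omega x /\ forall U : set E, open U -> U `<=` Omega -> U x ->
     exists2 phi : testfun Omega, supp phi `<=` U & u phi != 0].

End distributions.

Section sobolev.
Context {R : realType} {n : nat}.
Local Notation E := 'rV[R]_n.
Variable Omega : set E.
Local Notation functional := (functional Omega).
Implicit Types (s p theta : R) (u : functional) (f : E -> R).

Definition euclid_norm (x : E) : R := Num.sqrt (\sum_i (x ord0 i) ^+ 2).

Definition Lp_norm p f : \bar R := 'N[leb n]_(p%:E)[EFin \o (f \_ Omega)]%E.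

Definition Lp p : set (E -> R) :=
  [set f | measurable_fun Omega f /\ (Lp_norm p f < +oo)%E].

Definition gagliardo theta p f : \bar R :=
  ((\int[(leb n \x leb n)%E]_(z in Omega `*` Omega)
      (`|f z.1 - f z.2| `^ p /
       euclid_norm (z.1 - z.2) `^ (n%:R + theta * p))%:E) `^ p^-1)%E.

(* The functions of L^p(Omega) representing a distribution agree almost
   everywhere, so the infima [dLp_norm] and [dgagliardo] are the common value
   on these representatives; they are [+oo] if there is none. *)
Definition Lp_repr p u : set (E -> R) := [set f | Lp p f /\ u = dist_of f].

Definition dLp_norm p u : \bar R := ereal_inf [set Lp_norm p f | f in Lp_repr p u].

Definition dgagliardo theta p u : \bar R :=
  ereal_inf [set gagliardo theta p f | f in Lp_repr p u].

(* The norm of W^{s,p}(Omega) for [0 <= s], extended by [+oo] outside of the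
   space; [k] and [theta] are the integral and fractional parts of [s]. *)
Definition sobolev_norm_ge0 s p u : \bar R :=
  let k := Num.truncn s in
  let theta := s - k%:R in
  (\sum_(nu : midx n k | (ord nu <= k)%N) dLp_norm p (dpartial nu u) +
   (if theta == 0%R then 0 else
    \sum_(nu : midx n k | ord nu == k) dgagliardo theta p (dpartial nu u)))%E.

Definition sobolev_ge0 s p : set functional :=
  [set u | distributions u /\ (sobolev_norm_ge0 s p u < +oo)%E].

Definition sobolev0 s p : set functional :=
  [set u | sobolev_ge0 s p u /\ forall e : R, 0 < e ->
     exists phi : testfun Omega,
       (sobolev_norm_ge0 s p (u - dist_of phi)%R < e%:E)%E].

(* Linear functionals on W^{s,p}_0(Omega) are maps on all of [functional]
   of which only the restriction to [sobolev0 s p] matters. *)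
Definition linear_on_sobolev0 s p (F : functional -> R) :=
  forall (a : R) (v w : functional), sobolev0 s p v -> sobolev0 s p w ->
    F (a *: v + w) = a * F v + F w.

Definition dual_norm s p (F : functional -> R) : \bar R :=
  ereal_sup [set `|F w|%:E | w in
    [set w | sobolev0 s p w /\ (sobolev_norm_ge0 s p w <= 1)%E]].

(* The functionals on W^{s,p}_0(Omega) whose restriction to C_c^oo(Omega) is
   [u]; by density at most one of them is bounded. *)
Definition dual_ext s p u : set (functional -> R) :=
  [set F | linear_on_sobolev0 s p F /\
           forall phi : testfun Omega, F (dist_of phi) = u phi].

Definition sobolev_norm_lt0 s p u : \bar R :=
  let p' := p / (p - 1) in
  ereal_inf [set dual_norm (- s) p' F | F in dual_ext (- s) p' u].

Definition sobolev_norm s p u : \bar R :=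
  if 0 <= s then sobolev_norm_ge0 s p u else sobolev_norm_lt0 s p u.

Definition sobolev s p : set functional :=
  [set u | distributions u /\ (sobolev_norm s p u < +oo)%E].

Definition sobolev_supp s p (K : set E) : set functional :=
  [set u | sobolev s p u /\ dsupp u `<=` K].

Definition sobolev_loc s p : set functional :=
  [set u | distributions u /\
           forall phi : testfun Omega, sobolev s p (dmul phi u)].

Definition loc_seminorm s p (phi : testfun Omega) u : R :=
  fine (sobolev_norm s p (dmul phi u)).

Definition interior_smooth_multiplication_triple s p :=
  forall (phi : testfun Omega) (K : set E), compact K -> K `<=` Omega ->
    exists C : R, forall u, sobolev_supp s p K u ->
      sobolev_supp s p K (dmul phi u) /\
      (sobolev_norm s p (dmul phi u) <= C%:E * sobolev_norm s p u)%E.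

Definition admissible_family (A : set (testfun Omega)) :=
  forall x : E, Omega x -> exists2 phi, A phi &
    (forall y, 0 <= phi y) /\ phi x != 0.

End sobolev.

Section seminorm_topology.
Context {R : realType} {V : lmodType R}.
Implicit Types (X : set V) (q : V -> R) (P : set (V -> R)) (O : set (set V)).

Definition seminorm_on X q :=
  [/\ forall x, X x -> 0 <= q x,
      forall (a : R) x, X x -> q (a *: x) = `|a| * q x &
      forall x y, X x -> X y -> q (x + y) <= q x + q y].

Definition separating_family X P :=
  (forall q, P q -> seminorm_on X q) /\
  forall x, X x -> x != 0 -> exists2 q, P q & q x != 0.

(* [O] is the set of open sets of a topology on the subset [X]. *)
Definition topology_on X O :=
  [/\ O X,
      forall U, O U -> U `<=` X,
      forall F : set (set V), F `<=` O -> O (\bigcup_(U in F) U) &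
      forall U U', O U -> O U' -> O (U `&` U')].

Definition translation_invariant X O :=
  forall a U, X a -> O U -> O [set a + x | x in U].

Definition continuous_for X O q :=
  forall D : set R, open D -> O (X `&` q @^-1` D).

(* The smallest topology is the intersection of all the candidates. *)
Definition natural_topology X P : set (set V) :=
  \bigcap_(O in [set O | [/\ topology_on X O, translation_invariant X O &
                            forall q, P q -> continuous_for X O q]]) O.

End seminorm_topology.

(* Main.v *)
Require Import Defs.
From mathcomp Require Import all_boot all_order all_algebra.
From mathcomp Require Import all_classical all_reals all_analysis.
From mathcomp Require Import measurable_realfun.
From mathcomp Require Import ring lra.
Import Order.TTheory GRing.Theory Num.Theory.
Import numFieldNormedType.Exports.
Set Implicit Arguments.
Unset Strict Implicit.
Unset Printing Implicit Defensive.
Local Open Scope classical_set_scope.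
Local Open Scope ring_scope.

(** Fix [u] and a test function [phi]. Finitely many members [psi_1, ..., psi_m]
    of an admissible family have a sum that is positive on the compact support
    of [phi], so [eta = phi / (psi_1 + ... + psi_m)] is again a test function
    and [phi u = sum_i eta (psi_i u)] ([admissible_factorization],
    [dmul_factorization]). Each [psi_i u] has its support in the compact set
    [supp psi_i], hence multiplication by [eta] is bounded on it, and
      [|u|_phi <= C (|u|_psi_1 + ... + |u|_psi_m)]
    ([sobolev_norm_dominated]). This gives the first assertion at once. It also
    gives the third: a translation invariant topology for which the seminorms
    [|.|_psi_i] are continuous makes [|.|_phi] continuous, so both families have
    the same set of candidate topologies ([natural_topology_dominated]).

    For the second assertion, if every [|u|_psi] with [psi] in the family is [0]
    then every [psi u] is [0], and [u chi = sum_i (psi_i u) eta = 0] for each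
    test function [chi = sum_i psi_i eta]. What has to be known is that the norm
    of W^{s,p} vanishes only at [0], i.e. that [|v chi| <= c ||v||]
    ([testfun_le_sobolev_norm]). For [s >= 0] this is Hoelder's inequality. For
    [s < 0] it says that [chi] is, up to a scalar, in the unit ball of
    W^{-s,p'}_0, so test functions must have a finite W^{t,q} norm for all
    [t >= 0]. Their distributional derivatives are test functions by integration
    by parts ([integral_partial], [dpartial_testfun]), and their Gagliardo
    seminorms are finite by a dyadic decomposition around the diagonal
    ([gagliardo_lty]).

    The norms of this theory are infima, over representatives in L^p or over
    extensions of a functional, of norms that may be infinite. Their triangle
    inequality and homogeneity come from one lemma on infima along a linear
    relation ([ext_seminorm_inf]), fed with Minkowski's inequality. *)

(** * Boxes and Borel sets of R^n *)

Section rV_Borel.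
Context {R : realType} {n : nat}.
Local Notation E := 'rV[R]_n.

(** Boxes stand in for balls because the preimage of a box under [rV_cons] is a
    product, which makes their volume computable by induction on the dimension. *)
Definition cbox (x : E) (r : R) : set E := [set y | forall i, `|y ord0 i - x ord0 i| <= r].

Lemma rV_norm_ge (x : E) i : `|x ord0 i| <= `|x|.
Proof.
rewrite [leRHS]/Num.norm /= mx_normrE.
by rewrite (le_trans _ (le_bigmax _ _ (ord0, i))).
Qed.

Lemma rV_norm_le (x : E) (r : R) : 0 <= r -> (forall i, `|x ord0 i| <= r) -> `|x| <= r.
Proof.
move=> r0 xr; rewrite [leLHS]/Num.norm /= mx_normrE; apply/bigmax_leP; split => // -[i j] _.
by rewrite /= (ord1 i).
Qed.

Lemma cboxE (x y : E) r : 0 <= r -> cbox x r y <-> `|x - y| <= r.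
Proof.
move=> r0; rewrite distrC; split=> [h|h i].
  by apply: rV_norm_le => // i; rewrite !mxE; exact: h.
by apply: le_trans h; have := rV_norm_ge (y - x) i; rewrite !mxE.
Qed.

Lemma measurable_cbox (x : E) r : measurable (cbox x r).
Proof.
rewrite (_ : cbox x r = \bigcap_(i in [set: 'I_n])
    (@rV_coord R n i @^-1` `[x ord0 i - r, x ord0 i + r])); last first.
  by apply/seteqP; split=> y h i => [_|]; have := h i;
      rewrite /= in_itv/= ler_distl //; apply.
apply: fin_bigcap_measurable => // i _.
by rewrite -[X in measurable X]setTI; apply: measurable_rV_coord => //;
  exact: measurable_itv.
Qed.

(** The coordinate sigma-algebra contains the boxes, and an open set is the union
    of the boxes with rational centre and radius that it contains. *)
Lemma open_measurable_rV (U : set E) : open U -> measurable U.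
Proof.
move=> oU; pose F (z : 'rV[rat]_n * rat) : set E :=
  let B := cbox (map_mx ratr z.1) (ratr z.2) in
  if `[< B `<=` U >] then B else set0.
rewrite (_ : U = \bigcup_z F z); last first.
  apply/seteqP; split=> [x Ux|x [z _]]; last first.
    by rewrite /F; case: asboolP => //; exact.
  have /nbhs_ballP[e /= e0 eU] : nbhs x U by exact: open_nbhs_nbhs.
  have /rat_in_itvoo[q] : 0 < e / 2 by rewrite divr_gt0.
  rewrite in_itv/= => /andP[q0 qe].
  have H (i : 'I_n) : exists c : rat, `|ratr c - x ord0 i| < ratr q.
    have /rat_in_itvoo[c] : x ord0 i - ratr q < x ord0 i + ratr q.
      by rewrite ltrBlDr -addrA ltrDl addr_gt0.
    by rewrite in_itv/= -ltr_distl => ?; exists c.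
  have [c Hc] := choice H.
  exists (\row_i c i, q) => //; rewrite /F/=; case: asboolP => [_ i|[]].
    by rewrite !mxE distrC ltW.
  move=> y yB; apply: eU; split => // i j; rewrite (ord1 i).
  have := yB j; rewrite !mxE => h; rewrite /ball/=.
  rewrite (le_lt_trans (ler_distD (ratr (c j)) _ _))//.
  have := Hc j; rewrite distrC => h1.
  by rewrite [ltRHS]splitr ltrD// ?(lt_trans h1)// distrC (le_lt_trans h).
apply: countable_bigcupT_measurable => // z; rewrite /F; case: asboolP => // _.
exact: measurable_cbox.
Qed.

Lemma continuous_measurable_rV (f : E -> R) : continuous f -> measurable_fun setT f.
Proof.
move=> cf; apply: (measurability _ (RGenOpens.measurableE R)).
move=> _ [_ [a [b ->]] <-]; rewrite setTI; apply: open_measurable_rV.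
by move/continuousP : cf; apply; exact: interval_open.
Qed.

Lemma compact_sub_cbox (K : set E) : compact K -> exists2 r, 0 <= r & K `<=` cbox 0 r.
Proof.
move=> /compact_bounded[M [_ HM]]; exists (`|M| + 1); first by rewrite addr_ge0.
move=> x /HM h; apply/cboxE; first by rewrite addr_ge0.
by rewrite sub0r normrN; apply: h; rewrite (le_lt_trans (ler_norm _))// ltrDl.
Qed.

Lemma compact_cbox (x : E) r : compact (cbox x r).
Proof.
rewrite (_ : cbox x r =
    [set v : E | forall i, `[x ord0 i - r, x ord0 i + r]%classic (v ord0 i)]).
  by apply: (@rV_compact _ _ (fun i => `[x ord0 i - r, x ord0 i + r]%classic)) => i;
      exact: segment_compact.
by apply/seteqP; split=> y h i; have := h i; rewrite /= in_itv/= ler_distl.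
Qed.

Lemma continuous_compact_bounded (f : E -> R) (K : set E) : continuous f -> compact K ->
  (forall x, ~ K x -> f x = 0) -> exists2 M, 0 <= M & forall x, `|f x| <= M.
Proof.
move=> cf cK f0; have : compact (f @` K).
  by apply: continuous_compact => //; exact: continuous_subspaceT.
move=> /compact_bounded[M [_ HM]]; exists (`|M| + 1); first by rewrite addr_ge0.
move=> x; have [Kx|/f0->] := pselect (K x); last by rewrite normr0 addr_ge0.
by apply: HM; [rewrite (le_lt_trans (ler_norm _))// ltrDl|exists x].
Qed.

End rV_Borel.

Lemma leb_cbox {R : realType} n (x : 'rV[R]_n) r : 0 <= r ->
  leb n (cbox x r) = ((r *+ 2) ^+ n)%:E.
Proof.
elim: n x => [|n IH] x r0.
  rewrite /= diracE expr0 mem_set//; last by move=> [].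
rewrite /= /leb_step /pushforward.
rewrite (_ : _ @^-1` _ = `[x ord0 ord0 - r, x ord0 ord0 + r]%classic `*`
    cbox (\row_i x ord0 (lift ord0 i)) r); last first.
  apply/seteqP; split => [z h|z [/= h1 h2] i].
    split=> /=; first by have := h ord0; rewrite rV_cons0 in_itv/= ler_distl.
    by move=> i; have := h (lift ord0 i); rewrite rV_consS mxE.
  have [j ->|->] := unliftP ord0 i; first by have := h2 j; rewrite rV_consS mxE.
  by rewrite rV_cons0; move: h1; rewrite in_itv/= ler_distl.
rewrite product_measure1E//=; last exact: measurable_cbox.
rewrite IH// lebesgue_measure_itv/= lte_fin.
rewrite exprS EFinM; congr (_ * _)%E.
case: ifPn => [_|]; first by rewrite -EFinD; congr EFin; rewrite mulr2n; lra.
rewrite -leNgt => h; congr EFin; rewrite mulr2n; lra.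
Qed.

(** * Extended seminorms *)

Section ext_seminorm.
Context {R : realType}.

(** Since [0 * +oo = 0], the field [es_scale] includes [N 0 = 0]. The set [D] is
    for seminorms such as the L^p norm that are subadditive on measurable
    functions only. *)
Record ext_seminorm_on (V : lmodType R) (D : set V) (N : V -> \bar R) : Prop := {
  es_ge0 : forall u, (0 <= N u)%E ;
  es_add : forall u v, D u -> D v -> (N (u + v)%R <= N u + N v)%E ;
  es_scale : forall a u, D u -> (N (a *: u)%R <= `|a|%:E * N u)%E }.

Definition ext_seminorm (V : lmodType R) := @ext_seminorm_on V setT.

Lemma ext_seminorm0 (V : lmodType R) (N : V -> \bar R) : ext_seminorm N -> N 0 = 0%E.
Proof.
move=> [N0 _ /(_ 0 0 Logic.I)]; rewrite scale0r normr0 mul0e => NN.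
by apply/eqP; rewrite eq_le NN N0.
Qed.

Lemma ext_seminormZ (V : lmodType R) (N : V -> \bar R) a u : ext_seminorm N ->
  N (a *: u) = (`|a|%:E * N u)%E.
Proof.
move=> esN; have [->|a0] := eqVneq a 0.
  by rewrite scale0r normr0 mul0e ext_seminorm0.
apply/eqP; rewrite eq_le (es_scale esN)//=.
rewrite -lee_pdivlMl ?normr_gt0// -normfV.
by have := es_scale esN a^-1 (u := a *: u) Logic.I; rewrite scalerA mulVf// scale1r.
Qed.

Lemma ext_seminorm_cst0 (V : lmodType R) : ext_seminorm (fun _ : V => 0%E : \bar R).
Proof. by split=> [//|u v _ _|a u _]; rewrite ?adde0 ?mule0. Qed.

Lemma ext_seminormD (V : lmodType R) (N1 N2 : V -> \bar R) :
  ext_seminorm N1 -> ext_seminorm N2 -> ext_seminorm (fun u => (N1 u + N2 u)%E).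
Proof.
move=> e1 e2; split=> [u|u v _ _|a u _].
- by rewrite adde_ge0 ?(es_ge0 e1) ?(es_ge0 e2).
- by rewrite addeACA leeD ?(es_add e1) ?(es_add e2).
- by rewrite ge0_muleDr ?(es_ge0 e1) ?(es_ge0 e2)// leeD ?(es_scale e1) ?(es_scale e2).
Qed.

Lemma ext_seminorm_sum (V : lmodType R) (I : Type) (r : seq I) (P : pred I)
    (N : I -> V -> \bar R) :
  (forall i, P i -> ext_seminorm (N i)) ->
  ext_seminorm (fun u => (\sum_(i <- r | P i) N i u)%E).
Proof.
move=> eN; elim: r => [|i r IH].
  rewrite (_ : (fun _ => _) = fun=> 0%E); first exact: ext_seminorm_cst0.
  by apply/funext => u; rewrite big_nil.
have [Pi|nPi] := boolP (P i); last first.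
  by under eq_fun do rewrite big_cons (negbTE nPi).
under eq_fun do rewrite big_cons Pi.
by apply: ext_seminormD => //; exact: eN.
Qed.

Lemma ext_seminorm_comp (V W : lmodType R) (L : V -> W) (N : W -> \bar R) : linear L ->
  ext_seminorm N -> ext_seminorm (N \o L).
Proof.
move=> lL eN; have L0 : L 0 = 0.
  by have := lL (-1) 0 0; rewrite scaler0 addr0 scaleN1r addNr.
split=> [u|u v _ _|a u _] /=; first exact: (es_ge0 eN).
- by have := lL 1 u v; rewrite !scale1r => ->; exact: (es_add eN).
- by have := lL a u 0; rewrite addr0 L0 addr0 => ->; exact: (es_scale eN).
Qed.

(** Every norm below that is defined as an infimum has this form: [r u f] says
    that the function [f] represents [u], or that the functional [f] extends
    [u], and such [f] can be added and scaled along with [u]. *)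
Lemma ext_seminorm_inf (V W : lmodType R) (D : set W) (r : V -> set W) (N : W -> \bar R) :
  ext_seminorm_on D N -> (forall u, r u `<=` D) -> r 0 0 ->
  (forall a u v f g, r u f -> r v g -> r (a *: u + v) (a *: f + g)) ->
  ext_seminorm (fun u => ereal_inf [set N f | f in r u]).
Proof.
move=> eN rD r00 rL; set N' := fun u => _.
have N'0 u : (0 <= N' u)%E by apply: le_ereal_inf_tmp => _ [f _ <-]; exact: (es_ge0 eN).
have N'le u f : r u f -> (N' u <= N f)%E by move=> uf; apply: ereal_inf_lbound; exists f.
split=> [//|u v _ _|a u _].
  have [->|uoo] := eqVneq (N' u) +oo%E; first by rewrite addye ?leey// -ltNye
      (lt_le_trans _ (N'0 v)).
  have [->|voo] := eqVneq (N' v) +oo%E; first by rewrite addey ?leey// -ltNye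
      (lt_le_trans _ (N'0 u)).
  have ufin : N' u \is a fin_num by rewrite ge0_fin_numE// ltey.
  have vfin : N' v \is a fin_num by rewrite ge0_fin_numE// ltey.
  apply/lee_addgt0Pr => e e0; have e20 : 0 < e / 2 by rewrite divr_gt0.
  have [_ [f uf <-] fu] := lb_ereal_inf_adherent e20 ufin.
  have [_ [g vg <-] gv] := lb_ereal_inf_adherent e20 vfin.
  have uvfg : r (u + v) (f + g) by have := rL 1 _ _ _ _ uf vg; rewrite !scale1r.
  apply: le_trans (N'le _ _ uvfg) _.
  apply: le_trans (es_add eN (rD _ _ uf) (rD _ _ vg)) _.
  rewrite [e]splitr EFinD addeACA; apply: leeD; exact: ltW.
have [->|a0] := eqVneq a 0.
  rewrite scale0r normr0 mul0e; apply: le_trans (N'le _ _ r00) _.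
  by have := es_scale eN 0 (rD _ _ r00); rewrite scale0r normr0 mul0e.
rewrite -lee_pdivrMl ?normr_gt0//; apply: le_ereal_inf_tmp => _ [f uf <-].
rewrite lee_pdivrMl ?normr_gt0//; apply: le_trans (es_scale eN a (rD _ _ uf)); apply: N'le.
by have := rL a _ _ _ _ uf r00; rewrite !addr0.
Qed.

End ext_seminorm.

(** * Minkowski's inequality for the L^p and Gagliardo seminorms *)

Section Lp_seminorm.
Context {R : realType}.

(** Minkowski's inequality, together with homogeneity for norms that may be
    infinite. *)
Lemma ext_seminorm_Lnorm d (T : measurableType d) (mu : {measure set T -> \bar R}) (p : R) :
  1 <= p -> ext_seminorm_on [set f : T -> R^o | measurable_fun setT (f : T -> R)]
    (fun f : T -> R^o => 'N[mu]_(p%:E)[EFin \o (f : T -> R)])%E.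
Proof.
move=> p1; have p0 : 0 < p by exact: lt_le_trans p1.
split=> [f|f g mf mg|a f mf].
- exact: Lnorm_ge0.
- exact: minkowski_EFin.
- rewrite unlock /Lnorm/=.
  under eq_integral => x _ do rewrite -[a *: f]/(fun x => a * f x)/= normrM powRM// EFinM.
  rewrite ge0_integralZl_EFin//=; last first.
  + apply/measurable_EFinP; apply: (@measurableT_comp _ _ _ _ _ _ (@powR R ^~ p)) => //.
    exact: measurableT_comp.
  rewrite poweRM ?lee_fin ?powR_ge0 ?integral_ge0//.
  by rewrite poweR_EFin -powRrM mulfV ?gt_eqF// powRr1.
Qed.

End Lp_seminorm.

Section sobolev_seminorm.
Context {R : realType} {n : nat}.
Local Notation E := 'rV[R]_n.
Variable Omega : set E.
Hypothesis mO : measurable Omega.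

Lemma measurable_euclid_norm : measurable_fun setT (@euclid_norm R n).
Proof.
apply: (@measurableT_comp _ _ _ _ _ _ (@Num.sqrt R)).
  exact: continuous_measurable_fun (@sqrt_continuous R).
apply: measurable_sum => i; apply: measurable_funX.
exact: measurable_rV_coord.
Qed.

Lemma ext_seminorm_Lp_norm (p : R) : 1 <= p ->
  ext_seminorm_on [set f : E -> R^o | measurable_fun Omega (f : E -> R)] (Lp_norm Omega p).
Proof.
move=> p1; have eN := ext_seminorm_Lnorm (leb n) p1.
have m f : measurable_fun Omega (f : E -> R) -> measurable_fun setT (f \_ Omega).
  by move/measurable_restrictT; apply.
split=> [f|f g mf mg|a f mf]; rewrite /Lp_norm.
- exact: Lnorm_ge0.
- rewrite (_ : (f + g) \_ Omega = f \_ Omega + g \_ Omega); last first.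
    by apply/funext => x; rewrite /patch fctE; case: ifP => //; rewrite addr0.
  exact: (es_add eN (m _ mf) (m _ mg)).
- rewrite (_ : (a *: f) \_ Omega = a *: (f \_ Omega : E -> R^o)); last first.
    by apply/funext => x; rewrite /patch/= !fctE; case: ifP => // _; rewrite scaler0.
  exact: (es_scale eN a (m _ mf)).
Qed.

(** The Gagliardo seminorm of [f] is the L^p norm on the product space of this
    function, for [q = (n + theta p) / p]. *)
Definition diff_quot (q : R) (f : E -> R) (z : E * E) : R :=
  (f z.1 - f z.2) * euclid_norm (z.1 - z.2) `^ (- q).

Lemma measurable_diff_quot q f : measurable_fun Omega f ->
  measurable_fun (Omega `*` Omega) (diff_quot q f).
Proof.
move=> mf; apply: measurable_funM.
  apply: measurable_funB.
    apply: (@measurable_comp _ _ _ _ _ _ Omega) => //; last exact: measurable_funTS.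
    by move=> _ [z [? _] <-].
  apply: (@measurable_comp _ _ _ _ _ _ Omega) => //; last exact: measurable_funTS.
  by move=> _ [z [_ ?] <-].
apply: measurable_funTS.
apply: (@measurableT_comp _ _ _ _ _ _ (@powR R ^~ (- q))) => //.
apply: (@measurableT_comp _ _ _ _ _ _ (@euclid_norm R n)).
  exact: measurable_euclid_norm.
apply: measurable_fun_rV => i.
rewrite (_ : _ \o _ = (fun z => rV_coord i z.1 - rV_coord i z.2)); last first.
  by apply/funext => z; rewrite /rV_coord/= !mxE.
apply: measurable_funB.
  by apply: (@measurableT_comp _ _ _ _ _ _ (rV_coord i)) => //; exact: measurable_rV_coord.
by apply: (@measurableT_comp _ _ _ _ _ _ (rV_coord i)) => //; exact: measurable_rV_coord.
Qed.

Lemma diff_quot_powR (p N : R) (f : E -> R) z : 0 < p ->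
  `|diff_quot (N / p) f z| `^ p = `|f z.1 - f z.2| `^ p / euclid_norm (z.1 - z.2) `^ N.
Proof.
move=> p0; rewrite /diff_quot normrM powRM// (ger0_norm (powR_ge0 _ _)).
by rewrite -powRrM mulNr divfK ?gt_eqF// powRN.
Qed.

Lemma gagliardoE theta p f : 0 < p -> gagliardo Omega theta p f =
  'N[(leb n \x leb n)%E]_(p%:E)[EFin \o (diff_quot ((n%:R + theta * p) / p) f \_ (Omega
      `*` Omega))]%E.
Proof.
move=> p0; rewrite unlock /Lnorm/= /gagliardo integral_mkcond; congr (_ `^ _)%E.
apply: eq_integral => z _; rewrite /patch; case: ifPn => _.
  by rewrite -diff_quot_powR.
by rewrite -[point in RHS]/(0 : R) normr0 powR0// gt_eqF.
Qed.

Lemma ext_seminorm_gagliardo theta (p : R) : 1 <= p ->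
  ext_seminorm_on [set f : E -> R^o | measurable_fun Omega (f : E -> R)]
    (gagliardo Omega theta p).
Proof.
move=> p1; have p0 : 0 < p by exact: lt_le_trans p1.
have eN := ext_seminorm_Lnorm (leb n \x leb n)%E p1.
pose q := (n%:R + theta * p) / p.
have m f : measurable_fun Omega (f : E -> R) ->
  measurable_fun setT (diff_quot q f \_ (Omega `*` Omega)).
  move=> mf; apply/(measurable_restrictT _ _).1; first exact: measurableX.
  exact: measurable_diff_quot.
split=> [f|f g mf mg|a f mf]; rewrite !gagliardoE//.
- exact: Lnorm_ge0.
- rewrite (_ : _ \_ _ = diff_quot q f \_ (Omega `*` Omega) + diff_quot q g \_ (Omega
  `*` Omega)); last first.
    apply/funext => x; rewrite /patch fctE; case: ifP => // _; rewrite ?addr0//.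
    by rewrite /diff_quot/= -mulrDl fctE; congr (_ * _); rewrite opprD addrACA.
  exact: (es_add eN (m _ mf) (m _ mg)).
- rewrite (_ : _ \_ _ = a *: (diff_quot q f \_ (Omega `*` Omega) : E * E -> R^o));
  last first.
    apply/funext => x; rewrite /patch/= !fctE; case: ifP => // _; rewrite ?scaler0//.
    by rewrite /diff_quot/= -scalerBr scalerAl.
  exact: (es_scale eN a (m _ mf)).
Qed.

End sobolev_seminorm.

(** * Test functions, Hoelder's inequality and the Sobolev norms *)

Section testfun_facts.
Context {R : realType} {n : nat} {Omega : set 'rV[R]_n}.
Local Notation E := 'rV[R]_n.
Implicit Types phi psi : testfun Omega.

Lemma testfun_continuous phi : continuous (phi : E -> R).
Proof. exact: (testfun_smooth phi [::]).1. Qed.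

Lemma measurable_testfun phi : measurable_fun setT (phi : E -> R).
Proof. by apply: continuous_measurable_rV; exact: testfun_continuous. Qed.

Lemma supp_out (f : E -> R) x : ~ supp f x -> f x = 0.
Proof.
move=> nx; apply/eqP; apply: contrapT => /negP fx; apply: nx.
exact: subset_closure.
Qed.

Lemma compact_supp phi : compact (supp phi).
Proof. by have /Cc_smoothP[] := testfun_in phi. Qed.

Lemma supp_sub phi : supp phi `<=` Omega.
Proof. by have /Cc_smoothP[] := testfun_in phi. Qed.

Lemma testfun_bounded phi : exists2 M, 0 <= M & forall x, `|phi x| <= M.
Proof.
apply: continuous_compact_bounded (@compact_supp phi) _; first exact: testfun_continuous.
by move=> x; exact: supp_out.
Qed.

Lemma testfun_cbox phi : exists2 r, 0 <= r & forall x, ~ cbox 0 r x -> phi x = 0.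
Proof.
have [r r0 sr] := compact_sub_cbox (@compact_supp phi).
by exists r => // x nx; apply: supp_out => /sr.
Qed.

Lemma testfun_le_sup phi x : `|phi x| <= sup (range (fun x => `|phi x|)).
Proof.
have [M _ HM] := testfun_bounded phi.
by apply: ub_le_sup; [exists M => _ [y _ <-]; exact: HM|exists x].
Qed.

Lemma sup_norm_ge0 (f : E -> R) : 0 <= sup (range (fun x => `|f x|)).
Proof.
have [hs|] := pselect (has_sup (range (fun x => `|f x|))).
  by apply: (@le_trans _ _ `|f 0|) => //; apply: ub_le_sup; [exact: hs.2|exists 0].
by move=> /sup_out ->.
Qed.

End testfun_facts.

Lemma Lnorm_bounded_lty d (T : measurableType d) (R : realType)
    (mu : {measure set T -> \bar R}) (f : T -> R) (B : set T) (q M : R) :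
  0 < q -> 0 <= M -> measurable B -> (mu B < +oo)%E -> measurable_fun setT f ->
  (forall x, `|f x| <= M) -> (forall x, ~ B x -> f x = 0) ->
  ('N[mu]_(q%:E)[EFin \o f] < +oo)%E.
Proof.
move=> q0 M0 mB Bfin mf fM f0; rewrite unlock /Lnorm/=; apply: poweR_lty.
apply: (@le_lt_trans _ _ (\int[mu]_x ((M `^ q)%:E * (\1_B x)%:E))%E).
  apply: ge0_le_integral => //.
  - apply/measurable_EFinP; apply: (@measurableT_comp _ _ _ _ _ _ (@powR R ^~ q)) => //.
    exact: measurableT_comp.
  - by apply: emeasurable_funM => //; apply/measurable_EFinP; exact: measurable_indic.
  - move=> x _; have [Bx|nBx] := pselect (B x).
      by rewrite indicE mem_set// mule1 lee_fin ge0_ler_powR// ?nnegrE// ltW.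
    by rewrite f0// normr0 powR0 ?gt_eqF// mule_ge0// lee_fin powR_ge0.
rewrite ge0_integralZl_EFin ?powR_ge0//.
- by rewrite integral_indic// setIT lte_mul_pinfty// lee_fin powR_ge0.
- by apply/measurable_EFinP; exact: measurable_indic.
Qed.

Section dist_of_Lp.
Context {R : realType} {n : nat} {Omega : set 'rV[R]_n}.
Local Notation E := 'rV[R]_n.
Hypothesis mO : measurable Omega.
Implicit Types phi psi : testfun Omega.

Lemma Lnorm_testfun_lty phi (q : R) : 0 < q ->
  ('N[leb n]_(q%:E)[EFin \o (phi : E -> R)] < +oo)%E.
Proof.
move=> q0; have [M M0 HM] := testfun_bounded phi; have [r r0 Hr] := testfun_cbox phi.
apply: (@Lnorm_bounded_lty _ _ _ _ _ (cbox 0 r) _ M) => //.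
- exact: measurable_cbox.
- by rewrite [ltLHS](_ : _ = ((r *+ 2) ^+ n)%:E) ?ltry//; exact: leb_cbox.
- exact: measurable_testfun.
Qed.

Lemma testfun_restrict phi : (phi : E -> R) \_ Omega = phi :> (E -> R).
Proof.
apply/funext => x; rewrite /patch; case: ifPn => // /negP nx.
by rewrite supp_out// => /(@supp_sub _ _ _ phi) /mem_set.
Qed.

Lemma Lp_testfun phi (q : R) : 0 < q -> Lp Omega q (phi : E -> R).
Proof.
move=> q0; split; first by apply: measurable_funTS; exact: measurable_testfun.
by rewrite /Lp_norm testfun_restrict Lnorm_testfun_lty.
Qed.

Definition conj_exp (p : R) : R := p / (p - 1).

Lemma conj_exp_gt1 p : 1 < p -> 1 < conj_exp p.
Proof. by move=> p1; rewrite /conj_exp ltr_pdivlMr ?subr_gt0//; lra. Qed.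

(** This makes [dist_of] linear on L^p, and bounds the value of a distribution at
    a test function by its norm. *)
Lemma hoelder_testfun p (f : E -> R) phi : 1 < p -> measurable_fun Omega f ->
  (\int[leb n]_(x in Omega) `|(f x * phi x)%:E| <=
   Lp_norm Omega p f * 'N[leb n]_((conj_exp p)%:E)[EFin \o (phi : E -> R)])%E.
Proof.
move=> p1 mf; have p0 : 0 < p by exact: lt_trans p1.
have q1 := conj_exp_gt1 p1; have q0 : 0 < conj_exp p by exact: lt_trans q1.
have mF : measurable_fun setT (f \_ Omega) by apply/(measurable_restrictT _ _).1.
have pq : p^-1 + (conj_exp p)^-1 = 1.
  by rewrite /conj_exp invf_div -{1}(mul1r p^-1) -mulrDl addrC subrK divff ?gt_eqF.
apply: le_trans (hoelder (leb n) mF (measurable_testfun phi) p0 q0 pq).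
rewrite Lnorm1 [leLHS]integral_mkcond le_eqVlt; apply/orP; left; apply/eqP.
apply: eq_integral => x _. rewrite /patch/=; case: ifPn => // _.
by rewrite -[point in RHS]/(0 : R) mul0r normr0.
Qed.

Lemma Lp_mul_integrable p (f : E -> R) phi : 1 < p -> Lp Omega p f ->
  (leb n).-integrable Omega (fun x => (f x * phi x)%:E).
Proof.
move=> p1 [mf fp]; apply/integrableP; split.
  apply/measurable_EFinP; apply: measurable_funM => //.
  by apply: measurable_funTS; exact: measurable_testfun.
apply: le_lt_trans (hoelder_testfun _ p1 mf) _.
apply: lte_mul_pinfty; rewrite ?ge0_fin_numE// ?Lnorm_ge0//.
by apply: Lnorm_testfun_lty; exact: lt_trans (conj_exp_gt1 p1).
Qed.

Lemma dist_of_le p (f : E -> R) phi : 1 < p -> Lp Omega p f ->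
  (`|@dist_of R n Omega f phi|%:E <=
   Lp_norm Omega p f * 'N[leb n]_((conj_exp p)%:E)[EFin \o (phi : E -> R)])%E.
Proof.
move=> p1 Lf; apply: le_trans (hoelder_testfun phi p1 Lf.1).
have int := Lp_mul_integrable phi p1 Lf.
rewrite /dist_of /Rintegral -fine_abse ?integrable_fin_num// fineK ?abse_fin_num
  ?integrable_fin_num//.
by apply: le_abse_integral => //; exact: measurable_int int.
Qed.

Lemma dist_ofL p a (f g : E -> R^o) : 1 < p -> Lp Omega p f -> Lp Omega p g ->
  @dist_of R n Omega (a *: f + g) = a *: @dist_of R n Omega f + @dist_of R n Omega g.
Proof.
move=> p1 Lf Lg; apply/funext => phi; rewrite /dist_of/=.
have intf := Lp_mul_integrable phi p1 Lf.
have intg := Lp_mul_integrable phi p1 Lg.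
transitivity (\int[leb n]_(x in Omega) (a * (f x * phi x) + g x * phi x))%R.
  by apply: eq_Rintegral => x _; rewrite mulrA -mulrDl.
rewrite RintegralD//.
  by rewrite RintegralZl.
rewrite (_ : _ \o _ = (fun x => a%:E * (f x * phi x)%:E))%E; first exact: integrableZl.
by apply/funext => x /=; rewrite EFinM.
Qed.

Lemma LpL p a (f g : E -> R^o) : 1 < p -> Lp Omega p f -> Lp Omega p g ->
  Lp Omega p (a *: f + g).
Proof.
move=> p1 [mf fp] [mg gp]; have es := ext_seminorm_Lp_norm mO (ltW p1).
have maf : measurable_fun Omega (a *: f : E -> R) by exact: measurable_funM.
split; first exact: measurable_funD.
apply: le_lt_trans (es_add es maf mg) _; apply: lte_add_pinfty => //.
apply: le_lt_trans (es_scale es a mf) _; apply: lte_mul_pinfty => //.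
Qed.

Lemma Lp0 p : 1 < p -> Lp Omega p 0.
Proof. by move=> p1; exact: (Lp_testfun (0 : testfun Omega) (lt_trans ltr01 p1)). Qed.

Lemma dist_of0 : @dist_of R n Omega 0 = 0.
Proof.
apply/funext => phi; rewrite /dist_of/= (@eq_Rintegral _ _ _ _ _ (cst 0)).
  by rewrite Rintegral_cst// mul0r.
by move=> x _; rewrite fctE mul0r.
Qed.

Lemma dist_of_testfunZ a phi : @dist_of R n Omega (a *: phi) = a *: @dist_of R n Omega phi.
Proof.
have p1 : (1 < 2 :> R) by rewrite ltr1n.
have := dist_ofL a p1 (Lp_testfun phi (lt_trans ltr01 p1)) (Lp0 p1).
by rewrite addr0 dist_of0 addr0.
Qed.

Lemma Lp_reprL p a (u v : functional Omega) (f g : E -> R^o) : 1 < p ->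
  Lp_repr p u f -> Lp_repr p v g -> Lp_repr p (a *: u + v) (a *: f + g).
Proof.
move=> p1 [Lf ->] [Lg ->]; split; first exact: LpL.
by rewrite (dist_ofL a p1 Lf Lg).
Qed.

Lemma Lp_repr0 p : 1 < p -> Lp_repr p (0 : functional Omega) 0.
Proof. by move=> p1; split; [exact: Lp0|rewrite dist_of0]. Qed.

Lemma ext_seminorm_dLp_norm p : 1 < p -> ext_seminorm (dLp_norm (Omega := Omega) p).
Proof.
move=> p1; apply: (ext_seminorm_inf (ext_seminorm_Lp_norm mO (ltW p1))).
- by move=> u f [[]].
- exact: Lp_repr0.
- by move=> a u v f g; exact: Lp_reprL.
Qed.

Lemma ext_seminorm_dgagliardo theta p : 1 < p ->
  ext_seminorm (dgagliardo (Omega := Omega) theta p).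
Proof.
move=> p1; apply: (ext_seminorm_inf (ext_seminorm_gagliardo mO theta (ltW p1))).
- by move=> u f [[]].
- exact: Lp_repr0.
- by move=> a u v f g; exact: Lp_reprL.
Qed.

Lemma dpartial_linear k (nu : midx n k) : linear (@dpartial _ _ Omega k nu).
Proof.
move=> a u v; apply/funext => psi; rewrite /dpartial !fctE mulrDr; congr (_ + _).
by rewrite scalerAr.
Qed.

Lemma ext_seminorm_sobolev_ge0 s p : 1 < p ->
  ext_seminorm (sobolev_norm_ge0 (Omega := Omega) s p).
Proof.
move=> p1; apply: ext_seminormD.
  apply: ext_seminorm_sum => nu _; apply: ext_seminorm_comp (dpartial_linear nu) _.
  exact: ext_seminorm_dLp_norm.
set b := (_ == 0); case: b; first exact: ext_seminorm_cst0.
apply: ext_seminorm_sum => nu _; apply: ext_seminorm_comp (dpartial_linear nu) _.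
exact: ext_seminorm_dgagliardo.
Qed.

Lemma distributions0 : distributions (0 : functional Omega).
Proof.
split=> [a u v|K _ _]; first by rewrite -[RHS]/(a *: 0 + 0) scaler0 addr0.
by exists 0, 0%N => phi _; rewrite normr0 mul0r.
Qed.

Lemma sobolev0_0 s p : 1 < p -> sobolev0 (Omega := Omega) s p 0.
Proof.
move=> p1; have N0 := ext_seminorm0 (ext_seminorm_sobolev_ge0 s p1).
split; first by split; [exact: distributions0|rewrite N0 ltry].
by move=> e e0; exists 0; rewrite dist_of0 subr0 N0 lte_fin.
Qed.

(** The supremum that defines [dual_norm] is nonnegative because [0] belongs to
    [sobolev0]. *)
Lemma ext_seminorm_dual_norm s p : 1 < p ->
  ext_seminorm (dual_norm (Omega := Omega) s p : (functional Omega -> R^o) -> \bar R).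
Proof.
move=> p1; have N0 := ext_seminorm0 (ext_seminorm_sobolev_ge0 s p1).
have le F w : sobolev0 s p w -> (sobolev_norm_ge0 s p w <= 1)%E ->
    (`|F w|%:E <= dual_norm (Omega := Omega) s p F)%E.
  by move=> sw w1; apply: ereal_sup_ubound; exists w.
split=> [F|F G _ _|a F _].
- by apply: le_trans (le F 0 _ _); rewrite ?lee_fin ?N0//; exact: sobolev0_0.
- apply: ge_ereal_sup => _ [w [sw w1] <-].
  rewrite fctE (le_trans _ (leeD (le F w sw w1) (le G w sw w1)))//.
  by rewrite -EFinD lee_fin ler_normD.
- apply: ge_ereal_sup => _ [w [sw w1] <-].
  by rewrite -[a *: F]/(fun x => a * F x)/= normrM EFinM lee_wpmul2l// ?lee_fin// le.
Qed.

Lemma ext_seminorm_sobolev_lt0 s p : 1 < p ->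
  ext_seminorm (sobolev_norm_lt0 (Omega := Omega) s p).
Proof.
move=> p1; have es := ext_seminorm_dual_norm (- s) (conj_exp_gt1 p1).
apply: (ext_seminorm_inf es) => // [|a u v F G [Fl Fu] [Gl Gv]].
  by split=> [a v w _ _|//]; rewrite -[RHS]/(a * 0 + 0) mulr0 addr0.
have lin w : (a *: F + G) w = a * F w + G w by [].
split=> [b w1 w2 s1 s2|phi]; rewrite !lin; last by rewrite Fu Gv.
by rewrite Fl// Gl//; ring.
Qed.

Lemma ext_seminorm_sobolev s p : 1 < p -> ext_seminorm (sobolev_norm (Omega := Omega) s p).
Proof.
move=> p1; rewrite /sobolev_norm; case: (0 <= s).
  exact: ext_seminorm_sobolev_ge0.
exact: ext_seminorm_sobolev_lt0.
Qed.

End dist_of_Lp.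

(** * Integration by parts *)

Section slices.
Context {R : realType}.

Lemma is_derive_line n (f : 'rV[R]_n -> R) x v t : derivable f (x + t *: v) v ->
  is_derive t (1 : R) (fun t : R => f (x + t *: v)) ('D_v f (x + t *: v)).
Proof.
move=> df; have E : (fun h : R =>
      h^-1 *: (((fun t : R => f (x + t *: v)) \o shift t) (h *: 1) - f (x + t *: v)))
    = (fun h : R => h^-1 *: ((f \o shift (x + t *: v)) (h *: v) - f (x + t *: v))).
  apply/funext => h /=; congr (_ *: (f _ - _)).
  by rewrite scalerDl -[h *: 1]/(h * 1) mulr1 addrCA.
by apply: DeriveDef; rewrite /derivable /derive E.
Qed.

Lemma closed_cbox n (x : 'rV[R]_n) r : closed (cbox x r).
Proof. by apply: compact_closed; [exact: norm_hausdorff|exact: compact_cbox]. Qed.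

Lemma supp_cbox n (f : 'rV[R]_n -> R) r : (forall x, ~ cbox 0 r x -> f x = 0) ->
  supp f `<=` cbox 0 r.
Proof.
move=> f0; have /closure_id -> := @closed_cbox n 0 r.
by apply: closure_subset => x /=; apply: contraPP => /f0 ->; rewrite eqxx.
Qed.

Lemma partial_out n (f : 'rV[R]_n -> R) r i : (forall x, ~ cbox 0 r x -> f x = 0) ->
  forall x, ~ cbox 0 r x -> partial i f x = 0.
Proof.
move=> f0 x nx; apply: supp_out => h; apply: nx.
by apply: (supp_cbox f0); exact: partial_supp h.
Qed.

Lemma integrable_bounded d (T : measurableType d) (mu : {measure set T -> \bar R})
    (f : T -> R) (B : set T) (M : R) :
  0 <= M -> measurable B -> (mu B < +oo)%E -> measurable_fun setT f ->
  (forall x, `|f x| <= M) -> (forall x, ~ B x -> f x = 0) ->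
  mu.-integrable setT (EFin \o f).
Proof.
move=> M0 mB Bfin mf fM f0; apply/integrableP; split; first exact/measurable_EFinP.
by have := Lnorm_bounded_lty ltr01 M0 mB Bfin mf fM f0; rewrite Lnorm1.
Qed.

Lemma rV_cons_line n a (y : 'rV[R]_n) :
  rV_cons (a, y) = rV_cons (0, y) + a *: delta_mx ord0 ord0.
Proof.
apply/rowP => i; rewrite !mxE; have [j ->|->] := unliftP ord0 i.
  by rewrite /= mulr0 addr0.
by rewrite /= mulr1 add0r.
Qed.

Lemma rV_cons_add n a (y z : 'rV[R]_n) :
  rV_cons (a, z + y) = rV_cons (0, z) + rV_cons (a, y).
Proof.
apply/rowP => i; rewrite !mxE; have [j _|_] := unliftP ord0 i; first by rewrite /= mxE.
by rewrite /= add0r.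
Qed.

Lemma rV_cons_delta n t (j : 'I_n) : rV_cons (0, t *: delta_mx ord0 j) =
  t *: delta_mx ord0 (lift ord0 j) :> 'rV[R]_n.+1.
Proof.
apply/rowP => i; rewrite !mxE; have [k ->|->] := unliftP ord0 i.
  by rewrite /= !mxE (inj_eq lift_inj).
by rewrite /= mulr0.
Qed.

Lemma continuous_rV_cons_r n a : continuous (fun y : 'rV[R]_n => rV_cons (a, y)).
Proof.
move=> y U /nbhs_ballP[e /= e0 eU]; apply/nbhs_ballP; exists e => //= z [_ yz].
apply: eU; split=> // i j; rewrite (ord1 i) !mxE.
have [k _|_] := unliftP ord0 j; first exact: yz.
exact: ballxx.
Qed.

Lemma continuous_line n (x v : 'rV[R]_n) : continuous (fun t : R => x + t *: v).
Proof.
move=> t; apply: cvgD; first exact: cvg_cst.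
by apply: cvgZr_tmp; exact: cvg_id.
Qed.

(** Freezing the first coordinate commutes with the derivatives in the others. *)
Lemma partial_slice n (f : 'rV[R]_n.+1 -> R) a (j : 'I_n) y :
  (partial j (fun y => f (rV_cons (a, y))) y = partial (lift ord0 j) f (rV_cons (a, y))) /\
  (derivable f (rV_cons (a, y)) (delta_mx ord0 (lift ord0 j)) ->
   derivable (fun y => f (rV_cons (a, y))) y (delta_mx ord0 j)).
Proof.
have E : (fun h : R => h^-1 *: (((fun y => f (rV_cons (a,
  y))) \o shift y) (h *: delta_mx ord0 j) - f (rV_cons (a, y))))
  = (fun h : R => h^-1 *: ((f \o shift (rV_cons (a,
      y))) (h *: delta_mx ord0 (lift ord0 j)) - f (rV_cons (a, y)))).
  by apply/funext => h /=; congr (_ *: (f _ - _)); rewrite rV_cons_add rV_cons_delta.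
by split; rewrite /partial /derivable /derive E.
Qed.

(** The fundamental theorem of calculus on an interval whose endpoints lie
    outside the support. *)
Lemma integral_line_derive n (f : 'rV[R]_n -> R) (x v : 'rV[R]_n) (r : R) : 0 <= r ->
  continuous f ->
  (forall y, derivable f y v) -> continuous ('D_v f) ->
  (forall t : R, r < `|t| -> f (x + t *: v) = 0 /\ 'D_v f (x + t *: v) = 0) ->
  (\int[@lebesgue_measure R]_t ('D_v f (x + t *: v))%:E = 0)%E.
Proof.
move=> r0 cf df cdf f0; pose g (t : R) : R := 'D_v f (x + t *: v);
  pose F (t : R) := f (x + t *: v).
(* any radius larger than [r] keeps the endpoints out of the support *)
pose b : R := r + 1; have b0 : 0 < b by rewrite ltr_wpDl.
have nb : r < `|- b| by rewrite normrN gtr0_norm// ltrDl.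
have pb : r < `|b| by rewrite gtr0_norm// ltrDl.
have cg : continuous g.
  by move=> t; apply: (@continuous_comp _ _ _ (fun t : R => x + t *: v) ('D_v f));
      [exact: continuous_line|exact: cdf].
have cF : continuous F.
  by move=> t; apply: (@continuous_comp _ _ _ (fun t : R => x + t *: v) f);
      [exact: continuous_line|exact: cf].
transitivity (\int[@lebesgue_measure R]_(t in `[(- b)%R, b]) (g t)%:E)%E.
  rewrite [RHS]integral_mkcond; apply: eq_integral => t _; rewrite /patch;
      case: ifPn => // /negP nt.
  rewrite (f0 t _).2// ltNge; apply/negP => tr; apply: nt;
      rewrite inE/= in_itv/= -ler_norml.
  by rewrite (le_trans tr)// lerDl.
rewrite (@continuous_FTC2 _ g F).
- by rewrite /F (f0 _ pb).1 (f0 _ nb).1 subee.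
- by rewrite gtrN.
- exact: continuous_subspaceT.
- split.
  + by move=> t _; exact: (@ex_derive _ _ _ _ _ _ _ (is_derive_line (df (x + t *: v)))).
  + by apply: cvg_at_right_filter; exact: cF.
  + by apply: cvg_at_left_filter; exact: cF.
- by move=> t _; rewrite derive1E; exact: (@derive_val _ _ _ _ _ _ _ (is_derive_line
  (df (x + t *: v)))).
Qed.

(** Fubini's theorem splits off the first coordinate. If the derivative is in that
    direction, the inner integrals vanish by [integral_line_derive]; otherwise
    they do by the induction hypothesis on slices. *)
Lemma integral_partial n (f : 'rV[R]_n -> R) (i : 'I_n) (r : R) : 0 <= r -> continuous f ->
  (forall x, derivable f x (delta_mx ord0 i)) -> continuous (partial i f) ->
  (forall x, ~ cbox 0 r x -> f x = 0) ->
  (\int[leb n]_x (partial i f x)%:E = 0)%E.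
Proof.
elim: n f i => [|n IH] f i r0 cf df cdf f0; first by case: i df cdf => [].
have g0 := partial_out i f0.
have [M M0 HM] := continuous_compact_bounded cdf (@compact_cbox _ _ 0 r) g0.
have mg := continuous_measurable_rV cdf.
have mgc : measurable_fun setT (partial i f \o @rV_cons R n).
  by apply: measurableT_comp => //; exact: measurable_rV_cons.
have intg : ((@lebesgue_measure R) \x (leb n))%E.-integrable setT (EFin \o (partial i f
  \o @rV_cons R n)).
  apply: (@integrable_bounded _ _ _ _ (@rV_cons R n @^-1` (cbox 0 r)) M) => //.
  - rewrite -[X in measurable X]setTI; apply: measurable_rV_cons => //.
    exact: measurable_cbox.
  - rewrite [ltLHS](_ : _ = ((r *+ 2) ^+ n.+1)%:E) ?ltry//;
      exact: (@leb_cbox R n.+1 0 r r0).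
  - by move=> x; exact: HM.
  - by move=> x; exact: g0.
rewrite /= integral_pushforward//; last 2 first.
- exact: measurable_rV_cons.
- exact/measurable_EFinP.
rewrite preimage_setT.
have nbox0 a (y : 'rV[R]_n) : r < `|a| -> ~ cbox 0 r (rV_cons (a, y)).
  by move=> ra /(_ ord0); rewrite rV_cons0 mxE subr0/= leNgt ra.
have [j Ei|Ei] := unliftP ord0 i.
  rewrite -(integral12_prod_meas1 intg) integral0_eq// => a _; rewrite /fubini_F/=.
  have E y := partial_slice f a j y.
  have -> : (\int[leb n]_y (partial i f (rV_cons (a, y)))%:E =
            \int[leb n]_y (partial j (fun y => f (rV_cons (a, y))) y)%:E)%E.
    by apply: eq_integral => y _; rewrite (E y).1 -Ei.
  apply: IH => //.
  - by move=> y; apply: continuous_comp; [exact: continuous_rV_cons_r|exact: cf].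
  - by move=> y; apply: (E y).2; rewrite -Ei.
  - rewrite (_ : partial j _ = (fun y => partial i f (rV_cons (a, y)))); last first.
      by apply/funext => y; rewrite (E y).1 -Ei.
    by move=> y; apply: continuous_comp; [exact: continuous_rV_cons_r|exact: cdf].
  - move=> y ny; apply: f0 => h; apply: ny => k; have := h (lift ord0 k).
    by rewrite rV_consS !mxE.
rewrite -(integral21_prod_meas1 intg) integral0_eq// => y _; rewrite /fubini_G/=.
have E a : partial i f (rV_cons (a, y)) = 'D_(delta_mx ord0 i) f (rV_cons (0,
  y) + a *: delta_mx ord0 i).
  by rewrite rV_cons_line -Ei.
under eq_integral => a _ do rewrite E.
apply: (integral_line_derive r0) => // a ra; rewrite -/(partial i f) Ei -rV_cons_line.
by split; [apply: f0|rewrite -Ei; apply: g0]; exact: nbox0.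
Qed.

End slices.

Section dpartial_testfun.
Context {R : realType} {n : nat} {Omega : set 'rV[R]_n}.
Local Notation E := 'rV[R]_n.
Hypothesis mO : measurable Omega.
Implicit Types phi psi : testfun Omega.
Local Notation dist_of := (@dist_of R n Omega).

Lemma integral_testfun_partial phi i :
  \int[leb n]_(x in Omega) (partial i (phi : E -> R) x) = 0.
Proof.
have [r r0 Hr] := testfun_cbox phi.
have -> : \int[leb n]_(x in Omega) (partial i (phi : E -> R) x) =
    \int[leb n]_x (partial i (phi : E -> R) x).
  rewrite Rintegral_mkcond; congr Rintegral.
  exact: (testfun_restrict (partials_testfun [:: i] phi)).
rewrite /Rintegral (integral_partial r0)//.
- exact: testfun_continuous.
- by move=> x; exact: (testfun_smooth phi [::]).2.
- exact: (testfun_smooth phi [:: i]).1.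
Qed.

Lemma testfun_mul_integrable phi psi : (leb n).-integrable Omega (fun x =>
  (phi x * psi x)%:E).
Proof.
have p1 : (1 < 2 :> R) by rewrite ltr1n.
by apply: (Lp_mul_integrable mO psi p1); apply: Lp_testfun => //; exact: lt_trans p1.
Qed.

Lemma dist_of_partial phi psi i :
  dist_of phi (partials_testfun [:: i] psi) = - dist_of (partials_testfun [:: i] phi) psi.
Proof.
apply/eqP; rewrite -addr_eq0; apply/eqP.
rewrite -[RHS](integral_testfun_partial (mul_testfun phi psi) i) /dist_of
  -RintegralD//; last 2 first.
- exact: testfun_mul_integrable.
- exact: testfun_mul_integrable.
apply: eq_Rintegral => x _.
have d1 := (testfun_smooth phi [::]).2 x i; have d2 := (testfun_smooth psi [::]).2 x i.
by rewrite /partial/= (deriveM d1 d2)/= /partial -![_ *: _]/(_ * _); congr (_ + _);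
  rewrite mulrC.
Qed.

(** Each integration by parts moves the outermost derivative of [psi] onto [phi],
    which reverses the order of the derivatives. *)
Lemma dist_of_partials phi psi l :
  dist_of phi (partials_testfun l psi) = (-1) ^+ size l * dist_of (partials_testfun
      (rev l) phi) psi.
Proof.
elim: l phi => [|i l IH] phi.
  have nil (chi : testfun Omega) : partials_testfun [::] chi = chi by exact: val_inj.
  by rewrite expr0 mul1r !nil.
rewrite (_ : partials_testfun _ _ = partials_testfun [:: i] (partials_testfun l psi));
  last exact: val_inj.
rewrite dist_of_partial IH exprS mulN1r mulNr; congr (- (_ * _)).
rewrite (_ : partials_testfun (rev l) (partials_testfun [:: i] phi) =
  partials_testfun (rev (i :: l)) phi)//.
by apply: val_inj; rewrite /= rev_cons -cats1 partials_cat.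
Qed.

Lemma size_midx_seq k (nu : midx n k) : size (midx_seq nu) = ord nu.
Proof.
rewrite /midx_seq size_flatten /shape -map_comp sumnE big_map big_enum/= /ord.
by apply: eq_bigr => i _; rewrite /= size_nseq.
Qed.

Lemma dpartial_testfun k (nu : midx n k) phi :
  dpartial nu (dist_of phi) = dist_of (partials_testfun (rev (midx_seq nu)) phi).
Proof.
apply/funext => psi; rewrite /dpartial dist_of_partials size_midx_seq mulrA -exprMn.
by rewrite mulN1r opprK expr1n mul1r.
Qed.

(** A distribution of order [0]: its constant is the L^1 norm of [phi]. *)
Lemma distributions_testfun phi : distributions (dist_of phi).
Proof.
split=> [a psi1 psi2|K _ _].
  rewrite /dist_of -[RHS]/(a * _ + _) -RintegralZl//; last exact: testfun_mul_integrable.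
  rewrite -RintegralD//; last exact: testfun_mul_integrable.
    apply: eq_Rintegral => x _.
    rewrite -[(a *: psi1 + psi2 : testfun Omega) x]/(a * psi1 x + psi2 x); ring.
  rewrite (_ : _ \o _ = (fun x => a%:E * (phi x * psi1 x)%:E))%E; last first.
    by apply/funext => x /=; rewrite EFinM.
  by apply: integrableZl => //; exact: testfun_mul_integrable.
have intphi : (leb n).-integrable Omega (EFin \o (phi : E -> R)).
  have [M M0 HM] := testfun_bounded phi; have [r r0 Hr] := testfun_cbox phi.
  apply: (@integrableS _ _ _ _ setT) => //.
  apply: (@integrable_bounded _ _ _ _ _ (cbox 0 r) M) => //.
  - exact: measurable_cbox.
  - by rewrite [ltLHS](_ : _ = ((r *+ 2) ^+ n)%:E) ?ltry//; exact: leb_cbox.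
  - exact: measurable_testfun.
have intphi' : (leb n).-integrable Omega (EFin \o (fun x => `|phi x|)).
  exact: integrable_abse intphi.
exists (\int[leb n]_(x in Omega) `|phi x|), 0%N => psi _.
pose S := sup (range (fun x => `|psi x|)).
apply: (@le_trans _ _ ((\int[leb n]_(x in Omega) `|phi x|) * S)).
  have intpsi := testfun_mul_integrable phi psi.
  apply: le_trans (le_normr_Rintegral _ _) _ => //.
  rewrite -RintegralZr//; apply: le_Rintegral => //.
  - exact: integrable_abse intpsi.
  - rewrite (_ : _ \o _ = (fun x => S%:E * (`|phi x|)%:E))%E; last first.
      by apply/funext => x /=; rewrite EFinM muleC.
    exact: integrableZl intphi'.
  - move=> x _; rewrite normrM ler_wpM2l//; exact: testfun_le_sup.
apply: ler_wpM2l; first by apply: Rintegral_ge0.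
(* [phi] is estimated by the term of order 0 of the sum of suprema *)
pose nu0 : midx n 0 := [ffun=> ord0].
rewrite (bigD1 nu0)/=; last by rewrite /ord big1// => i _; rewrite ffunE.
rewrite (_ : midx_seq nu0 = [::]); last first.
  by apply/size0nil; rewrite size_midx_seq /ord big1// => i _; rewrite ffunE.
by rewrite /= lerDl sumr_ge0// => nu _; exact: sup_norm_ge0.
Qed.

End dpartial_testfun.

(** * Gagliardo seminorms of test functions *)

Section lipschitz.
Context {R : realType} {n : nat}.
Local Notation E := 'rV[R]_n.

Lemma partial_increment (f : E -> R) (i : 'I_n) (M : R) x t :
  (forall y, derivable f y (delta_mx ord0 i)) -> (forall y, `|partial i f y| <= M) ->
  `|f (x + t *: delta_mx ord0 i) - f x| <= M * `|t|.
Proof.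
move=> df fM.
have pos y s : 0 <= s -> `|f (y + s *: delta_mx ord0 i) - f y| <= M * `|s|.
  move=> s0; pose F (t : R) := f (y + t *: delta_mx ord0 i).
  have dF (u : R) := is_derive_line (df (y + u *: delta_mx ord0 i)).
  have [|c _] := MVT_segment s0 (fun u _ => dF u).
    by apply: derivable_within_continuous => u _; exact: (@ex_derive _ _ _ _ _ _ _ (dF u)).
  by rewrite scale0r addr0 subr0 => ->; rewrite normrM ler_wpM2r//; exact: fM.
have [t0|t0] := leP 0 t; first exact: pos.
have := pos (x + t *: delta_mx ord0 i) (- t); rewrite oppr_ge0 => /(_ (ltW t0)).
by rewrite scaleNr addrK normrN distrC.
Qed.

(** One coordinate is changed at a time, and each change is estimated by the mean
    value theorem along a coordinate line. *)
Lemma lipschitz_of_partials (f : E -> R) (M : R) : 0 <= M ->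
  (forall y i, derivable f y (delta_mx ord0 i)) -> (forall y i, `|partial i f y| <= M) ->
  forall x y, `|f x - f y| <= n%:R * M * `|x - y|.
Proof.
move=> M0 df fM x y; pose z k : E := \row_i (if (i < k)%N then x ord0 i else y ord0 i).
have H k : (k <= n)%N -> `|f (z k) - f y| <= k%:R * (M * `|x - y|).
  elim: k => [_|k IH kn].
    rewrite (_ : z 0%N = y) ?subrr ?normr0 ?mul0r//.
    by apply/rowP => i; rewrite mxE.
  have -> : z k.+1 = z k + (x - y) ord0 (Ordinal kn) *: delta_mx ord0 (Ordinal kn).
    apply/rowP => i; rewrite !mxE/= ltnS leq_eqVlt -val_eqE/=.
    case: eqP => [ik|ik]/=.
      have -> : i = Ordinal kn by exact: val_inj.
      by rewrite /= ltnn mulr1 addrCA subrr addr0.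
    by rewrite mulr0 addr0.
  rewrite (le_trans (ler_distD (f (z k)) _ _))// -natr1 mulrDl mul1r addrC lerD//.
    exact: IH (ltnW kn).
  rewrite (le_trans (partial_increment _ _ (fun y => df y _) (fun y => fM y _)))//.
  by rewrite ler_wpM2l// rV_norm_ge.
have := H n (leqnn n); rewrite mulrA (_ : z n = x)//.
by apply/rowP => i; rewrite mxE ltn_ord.
Qed.

Lemma testfun_lipschitz (Omega : set E) (phi : testfun Omega) :
  exists2 L, 0 <= L & forall x y, `|phi x - phi y| <= L * `|x - y|.
Proof.
have H (i : 'I_n) : exists M, 0 <= M /\ forall x, `|partial i (phi : E -> R) x| <= M.
  by have [M M0 HM] := testfun_bounded (partials_testfun [:: i] phi); exists M.
have [M HM] := choice H.
have S0 : 0 <= \sum_i M i by apply: sumr_ge0 => i _; exact: (HM i).1.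
exists (n%:R * \sum_i M i); first by rewrite mulr_ge0.
apply: lipschitz_of_partials => // y i; first exact: (testfun_smooth phi [::]).2.
apply: le_trans ((HM i).2 y) _; rewrite (bigD1 i)//= lerDl sumr_ge0// => j _.
exact: (HM j).1.
Qed.

End lipschitz.

Section near_diagonal.
Context {R : realType} {n : nat}.
Local Notation E := 'rV[R]_n.

(** A pair of points contributes to the Gagliardo integral only if one of them is in
    a box that contains the support: the first for [strip1], the second for
    [strip2]. *)
Definition strip1 (r rho : R) : set (E * E) := [set z | cbox 0 r z.1 /\ cbox z.1 rho z.2].
Definition strip2 (r rho : R) : set (E * E) := [set z | cbox 0 r z.2 /\ cbox z.2 rho z.1].

Lemma measurable_near_diag (rho : R) : measurable [set z : E * E | cbox z.1 rho z.2].
Proof.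
rewrite (_ : [set z | _] = \bigcap_(i in [set: 'I_n])
   ((fun z : E * E => rV_coord i z.2 - rV_coord i z.1) @^-1` `[(- rho), rho])); last first.
  by apply/seteqP; split=> z h i => [_|]; have := h i;
      rewrite /= in_itv/= -ler_norml//; apply.
apply: fin_bigcap_measurable => // i _.
have mc := @measurable_rV_coord R n i.
have mf : measurable_fun setT (fun z : E * E => rV_coord i z.2 - rV_coord i z.1).
  by apply: measurable_funB; exact: (@measurableT_comp _ _ _ _ _ _ (rV_coord i)).
by rewrite -[X in measurable X]setTI; apply: mf => //; exact: measurable_itv.
Qed.

Lemma measurable_strip1 r rho : measurable (strip1 r rho).
Proof.
apply: measurableI; last exact: measurable_near_diag.
by rewrite -[X in measurable X]setTI; apply: measurable_fst => //; exact: measurable_cbox.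
Qed.

Lemma cbox_sym (x y : E) r : cbox x r y -> cbox y r x.
Proof. by move=> h i; rewrite distrC. Qed.

Lemma measurable_strip2 r rho : measurable (strip2 r rho).
Proof.
rewrite (_ : strip2 r rho = [set z | cbox 0 r z.2] `&` [set z | cbox z.1 rho z.2]);
  last first.
  by apply/seteqP; split=> z [h1 /cbox_sym h2].
apply: measurableI; last exact: measurable_near_diag.
by rewrite -[X in measurable X]setTI; apply: measurable_snd => //; exact: measurable_cbox.
Qed.

(** The slice of [strip1] over [x] is a box of radius [rho], whose volume does
    not depend on [x]. *)
Lemma integral_strip_slice (r rho : R) (x : E) : 0 <= rho ->
  (\int[leb n]_y (\1_[set y | cbox 0 r x /\ cbox x rho y] y)%:E =
   ((rho *+ 2) ^+ n)%:E * (\1_(cbox 0 r) x)%:E)%E.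
Proof.
move=> rho0; have [Bx|nBx] := pselect (cbox 0 r x).
  rewrite (_ : [set y | _] = cbox x rho); last by apply/seteqP; split=> y // [].
  rewrite integral_indic//; last exact: measurable_cbox.
  by rewrite setIT indicE mem_set// mule1; exact: leb_cbox.
rewrite (_ : [set y | _] = set0); last by apply/seteqP; split=> y // [].
by rewrite indic0 integral0 indicE memNset// mule0.
Qed.

Lemma integral_strip1 (r rho : R) : 0 <= r -> 0 <= rho ->
  (\int[(leb n \x leb n)%E]_z (\1_(strip1 r rho) z)%:E =
      ((rho *+ 2) ^+ n * (r *+ 2) ^+ n)%:E)%E.
Proof.
move=> r0 rho0; rewrite fubini_tonelli1//=; last first.
  by apply/measurable_EFinP; apply: measurable_indic; exact: measurable_strip1.
transitivity (\int[leb n]_x (((rho *+ 2) ^+ n)%:E * (\1_(cbox 0 r) x)%:E))%E.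
  by apply: eq_integral => x _; rewrite -integral_strip_slice//.
rewrite ge0_integralZl_EFin//; last 2 first.
- by apply/measurable_EFinP; apply: measurable_indic; exact: measurable_cbox.
- by rewrite exprn_ge0// mulrn_wge0.
rewrite integral_indic//; last exact: measurable_cbox.
by rewrite setIT EFinM; congr (_ * _)%E; exact: leb_cbox.
Qed.

Lemma integral_strip2 (r rho : R) : 0 <= r -> 0 <= rho ->
  (\int[(leb n \x leb n)%E]_z (\1_(strip2 r rho) z)%:E =
      ((rho *+ 2) ^+ n * (r *+ 2) ^+ n)%:E)%E.
Proof.
move=> r0 rho0; rewrite fubini_tonelli2//=; last first.
  by apply/measurable_EFinP; apply: measurable_indic; exact: measurable_strip2.
transitivity (\int[leb n]_x (((rho *+ 2) ^+ n)%:E * (\1_(cbox 0 r) x)%:E))%E.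
  by apply: eq_integral => x _; rewrite -integral_strip_slice//.
rewrite ge0_integralZl_EFin//; last 2 first.
- by apply/measurable_EFinP; apply: measurable_indic; exact: measurable_cbox.
- by rewrite exprn_ge0// mulrn_wge0.
rewrite integral_indic//; last exact: measurable_cbox.
by rewrite setIT EFinM; congr (_ * _)%E; exact: leb_cbox.
Qed.

End near_diagonal.

Section dyadic.
Context {R : realType}.

(** Powers of [2] with real exponents let all the factors of the estimates below be
    combined into one power. *)
Lemma dyadic_powR (x : R) : 1 <= x ->
  exists k : nat, (2 : R) `^ k%:R <= x /\ x < 2 `^ k.+1%:R.
Proof.
move=> x1; have x0 : 0 <= x by exact: le_trans x1.
have /andP[tx xt] := Num.Theory.trunc_itv x0; set m := Num.trunc x in tx xt.
have m0 : (0 < m)%N.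
  by rewrite lt0n; apply/eqP => m0; move: xt; rewrite m0 ltNge x1.
have /andP[km mk] := trunc_log_bounds (isT : (1 < 2)%N) m0.
exists (trunc_log 2 m); rewrite !powR_mulrn//; split.
  by apply: le_trans tx; rewrite -natrX ler_nat.
by apply: lt_le_trans xt _; rewrite -natrX ler_nat.
Qed.

Lemma sum_geometric_le (a : R) (m : nat) : 0 <= a -> a < 1 ->
  \sum_(0 <= k < m) a ^+ k <= (1 - a)^-1.
Proof.
move=> a0 a1; rewrite -[leRHS]mul1r ler_pdivlMr ?subr_gt0// big_mkord.
have := subrX1 a m; have : 0 <= a ^+ m by rewrite exprn_ge0.
by move=> am e; rewrite mulrC -opprB mulNr -e opprB gerBl.
Qed.

Lemma nneseries_geometric_lty (u : nat -> \bar R) (K1 K2 a b : R) :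
  0 <= a -> a < 1 -> 0 <= b -> b < 1 -> 0 <= K1 -> 0 <= K2 ->
  (forall k, 0 <= u k)%E -> (forall k, u k <= (K1 * a ^+ k + K2 * b ^+ k)%:E)%E ->
  (\sum_(0 <= k <oo) u k < +oo)%E.
Proof.
move=> a0 a1 b0 b1 K10 K20 u0 uk.
apply: (@le_lt_trans _ _ (K1 * (1 - a)^-1 + K2 * (1 - b)^-1)%:E); last exact: ltry.
apply: lime_le; first by apply: is_cvg_nneseries => k _ _; exact: u0.
apply: nearW => m;
  apply: (@le_trans _ _ (\sum_(0 <= k < m) (K1 * a ^+ k + K2 * b ^+ k)%:E)%E).
  by apply: lee_sum.
rewrite sumEFin lee_fin big_split/= -!mulr_sumr.
by rewrite lerD// ler_wpM2l// sum_geometric_le.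
Qed.

End dyadic.

Section gagliardo_finite.
Context {R : realType} {n : nat} {Omega : set 'rV[R]_n}.
Local Notation E := 'rV[R]_n.
Hypothesis mO : measurable Omega.

Lemma norm_le_euclid (x : E) : `|x| <= euclid_norm x.
Proof.
apply: rV_norm_le => [|i]; first exact: sqrtr_ge0.
rewrite -sqrtr_sqr /euclid_norm ler_wsqrtr// (bigD1 i)//= lerDl sumr_ge0// => j _.
exact: sqr_ge0.
Qed.

(** The Gagliardo integrand for an increment [v] between points at distance [e],
    at scale [D]. *)
Lemma quotient_le (p N A D e : R) (v : R) : 0 < p -> 0 <= N -> `|v| <= A ->
  0 < D -> D <= e -> `|v| `^ p / e `^ N <= A `^ p * D `^ (- N).
Proof.
move=> p0 N0 vA D0 De; have A0 : 0 <= A by exact: le_trans vA.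
rewrite powRN ler_pM ?powR_ge0 ?invr_ge0 ?powR_ge0//.
  by apply: ge0_ler_powR; rewrite ?nnegrE// ltW.
rewrite lef_pV2 ?posrE ?powR_gt0//; last exact: lt_le_trans De.
by apply: ge0_ler_powR; rewrite ?nnegrE// ltW// (lt_le_trans D0).
Qed.

Definition strips (r rho : R) (z : E * E) : R := \1_(strip1 r rho) z + \1_(strip2 r rho) z.

Lemma strips_ge0 r rho z : 0 <= strips r rho z.
Proof. by rewrite /strips addr_ge0. Qed.

Lemma measurable_strips r rho : measurable_fun setT (strips r rho).
Proof.
apply: measurable_funD; apply: measurable_indic.
- exact: measurable_strip1.
- exact: measurable_strip2.
Qed.

Lemma strips_ge1 r rho z : cbox 0 r z.1 \/ cbox 0 r z.2 -> 0 <= rho ->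
  `|z.1 - z.2| <= rho -> 1 <= strips r rho z.
Proof.
move=> h rho0 /(cboxE _ _ rho0) hz; rewrite /strips; case: h => h.
  by rewrite [X in X + _](_ : _ = 1) ?lerDl// indicE mem_set.
rewrite [X in _ + X](_ : _ = 1) ?lerDr// indicE mem_set//.
by split => //; exact: cbox_sym.
Qed.

Lemma integral_strips r rho : 0 <= r -> 0 <= rho ->
  (\int[(leb n \x leb n)%E]_z (strips r rho z)%:E =
   ((rho *+ 2) ^+ n * (r *+ 2) ^+ n *+ 2)%:E)%E.
Proof.
move=> r0 rho0; rewrite /strips; under eq_integral do rewrite EFinD.
rewrite ge0_integralD//; last 2 first.
- by apply/measurable_EFinP; apply: measurable_indic; exact: measurable_strip1.
- by apply/measurable_EFinP; apply: measurable_indic; exact: measurable_strip2.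
by rewrite integral_strip1// integral_strip2// -EFinD -mulr2n.
Qed.

(** A bound of the Gagliardo integrand on the shell
    [2^-(k+1) <= |x - y| <= 2^-k], by the Lipschitz constant [L] of the function;
    [far_coef] is one for [2^k <= |x - y| <= 2^(k+1)], by a bound [M]. *)
Definition near_coef (p N L : R) (k : nat) : R :=
  (L * 2 `^ (- k%:R)) `^ p * (2 `^ (- k.+1%:R)) `^ (- N).

Definition far_coef (p N M : R) (k : nat) : R := (M *+ 2) `^ p * (2 `^ k%:R) `^ (- N).

Lemma near_coef_ge0 p N L k : 0 <= near_coef p N L k.
Proof. by rewrite mulr_ge0 ?powR_ge0. Qed.

Lemma far_coef_ge0 p N M k : 0 <= far_coef p N M k.
Proof. by rewrite mulr_ge0 ?powR_ge0. Qed.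

(** If the integrand does not vanish then one of the two points is in the box that
    contains the support, and their distance belongs to some dyadic shell. *)
Lemma quotient_dyadic (f : E -> R) (p N L M r : R) z :
  0 < p -> 0 <= N -> 0 <= L -> 0 <= M ->
  (forall x y, `|f x - f y| <= L * `|x - y|) -> (forall x, `|f x| <= M) ->
  (forall x, ~ cbox 0 r x -> f x = 0) ->
  let G := `|f z.1 - f z.2| `^ p / euclid_norm (z.1 - z.2) `^ N in
  G = 0 \/ exists k, G <= near_coef p N L k * strips r (2 `^ (- k%:R)) z \/
    G <= far_coef p N M k * strips r (2 `^ k.+1%:R) z.
Proof.
move=> p0 N0 L0 M0 fL fM f0 G.
have G0 : f z.1 - f z.2 = 0 -> G = 0.
  by move=> e; rewrite /G e normr0 powR0 ?gt_eqF// mul0r.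
have [nB|B] := pselect (~ (cbox 0 r z.1 \/ cbox 0 r z.2)).
  left; apply: G0; rewrite (f0 z.1) ?(f0 z.2) ?subrr//.
    by move=> h; apply: nB; right.
  by move=> h; apply: nB; left.
move/contrapT : B => B.
have [D0|Dn0] := eqVneq `|z.1 - z.2| 0.
  by left; apply: G0; apply/eqP; rewrite -normr_le0 (le_trans (fL _ _))// D0 mulr0.
have Dp : 0 < `|z.1 - z.2| by rewrite lt_neqAle eq_sym Dn0 normr_ge0.
have De := norm_le_euclid (z.1 - z.2).
have le_strips (A D rho : R) : `|f z.1 - f z.2| <= A -> 0 < D -> D <= `|z.1 - z.2| ->
    0 <= rho -> `|z.1 - z.2| <= rho -> G <= A `^ p * D `^ (- N) * strips r rho z.
  move=> fA D0 DD rho0 Drho; rewrite -[leLHS]mulr1; apply: ler_pM => //.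
  - by rewrite /G mulr_ge0 ?invr_ge0 ?powR_ge0.
  - by apply: (quotient_le p0 N0 fA D0); exact: le_trans De.
  - exact: strips_ge1.
have two0 : (0 : R) < 2 by [].
right; have [D1|D1] := leP `|z.1 - z.2| 1.
  have [|k [k1 k2]] := @dyadic_powR R `|z.1 - z.2|^-1; first by rewrite invf_ge1.
  have kD : `|z.1 - z.2| <= 2 `^ (- k%:R).
    by rewrite powRN -[leLHS]invrK lef_pV2// posrE ?invr_gt0// powR_gt0.
  have Dk : 2 `^ (- k.+1%:R) <= `|z.1 - z.2|.
    by rewrite powRN -[leRHS]invrK lef_pV2 ?ltW// posrE ?invr_gt0// powR_gt0.
  exists k; left.
  apply: (fun h => le_strips _ _ _ h (powR_gt0 _ two0) Dk (powR_ge0 _ _) kD).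
  by rewrite (le_trans (fL _ _))// ler_wpM2l.
have [k [k1 k2]] := dyadic_powR (ltW D1).
exists k; right.
apply: (fun h => le_strips _ _ _ h (powR_gt0 _ two0) k1 (powR_ge0 _ _) (ltW k2)).
by rewrite (le_trans (ler_normB _ _))// mulr2n lerD.
Qed.

Lemma powR2D (x y : R) : (2 : R) `^ (x + y) = 2 `^ x * 2 `^ y.
Proof. by rewrite powRD// pnatr_eq0 implybT. Qed.

Lemma powR2X (a : R) (k : nat) : ((2 : R) `^ a) ^+ k = 2 `^ (a * k%:R).
Proof. by rewrite -powR_mulrn ?powR_ge0// -powRrM. Qed.

Lemma powR2_lt1 (e : R) : 0 < e -> (2 : R) `^ (- e) < 1.
Proof.
move=> e0; rewrite powRN invf_lt1 ?powR_gt0//.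
rewrite [ltLHS](_ : 1 = 1 `^ e); last by rewrite powR1.
apply: gt0_ltr_powR => //; rewrite ?nnegrE//.
by rewrite ltr1n.
Qed.

(** With [N = n + theta p], the exponents of [2] that depend on the shell add up to
    [- k p + (k + 1) N - k n = N - k (1 - theta) p], so the sum over [k] is
    geometric because [theta < 1]. *)
Lemma near_coef_volume (p theta L X : R) k : 0 <= L ->
  near_coef p (n%:R + theta * p) L k * ((2 `^ (- k%:R) *+ 2) ^+ n * X *+ 2) =
  L `^ p * 2 `^ (n%:R + theta * p) * (2 ^+ n * X *+ 2) * (2 `^ (- ((1 - theta) * p))) ^+ k.
Proof.
move=> L0; rewrite /near_coef powRM ?powR_ge0// -!powRrM.
rewrite -[_ *+ 2 in X in _ * (X ^+ n * _ *+ 2)]mulr_natr exprMn !powR2X.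
set Y := (2 : R) ^+ n.
transitivity (L `^ p * (2 `^ (- k%:R * p) * 2 `^ (- k.+1%:R * - (n%:R + theta * p)) *
  2 `^ (- k%:R * n%:R)) * (Y * X *+ 2)).
  by ring.
rewrite -!powR2D.
transitivity (L `^ p * (2 `^ (n%:R + theta * p) * 2 `^ (- ((1 - theta) * p) * k%:R)) *
  (Y * X *+ 2)); last by ring.
rewrite -powR2D; congr (_ * 2 `^ _ * _); rewrite -natr1; ring.
Qed.

(** Here the exponents add up to [- k N + (k + 1) n = n - k theta p], so the sum
    over [k] is geometric because [0 < theta]. *)
Lemma far_coef_volume (p theta M X : R) k :
  far_coef p (n%:R + theta * p) M k * ((2 `^ k.+1%:R *+ 2) ^+ n * X *+ 2) =
  (M *+ 2) `^ p * 2 `^ n%:R * (2 ^+ n * X *+ 2) * (2 `^ (- (theta * p))) ^+ k.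
Proof.
rewrite /far_coef -!powRrM.
rewrite -[_ *+ 2 in X in _ * (X ^+ n * _ *+ 2)]mulr_natr exprMn !powR2X.
set Y := (2 : R) ^+ n.
transitivity ((M *+ 2) `^ p * (2 `^ (k%:R * - (n%:R + theta * p)) *
  2 `^ (k.+1%:R * n%:R)) * (Y * X *+ 2)).
  by ring.
rewrite -!powR2D.
transitivity ((M *+ 2) `^ p * (2 `^ n%:R * 2 `^ (- (theta * p) * k%:R)) *
  (Y * X *+ 2)); last by ring.
rewrite -powR2D; congr (_ * 2 `^ _ * _); rewrite -natr1; ring.
Qed.

(** The integrand is at most a series of multiples of indicators of strips, whose
    integrals are dominated by two geometric series. *)
Lemma gagliardo_lty (f : E -> R) (theta p L M r : R) : 1 <= p -> 0 < theta -> theta < 1 ->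
  measurable_fun Omega f -> 0 <= L -> 0 <= M -> 0 <= r ->
  (forall x y, `|f x - f y| <= L * `|x - y|) -> (forall x, `|f x| <= M) ->
  (forall x, ~ cbox 0 r x -> f x = 0) ->
  (gagliardo Omega theta p f < +oo)%E.
Proof.
move=> p1 th0 th1 mf L0 M0 r0 fL fM f0; have p0 : 0 < p by exact: lt_le_trans p1.
pose N := n%:R + theta * p; have N0 : 0 < N by rewrite ltr_wpDl// mulr_gt0.
pose G (z : E * E) : R := `|f z.1 - f z.2| `^ p / euclid_norm (z.1 - z.2) `^ N.
have mG : measurable_fun (Omega `*` Omega) (fun z => (G z)%:E).
  apply/measurable_EFinP; rewrite (_ : G = (fun z => `|diff_quot (N / p) f z| `^ p));
      last first.
    by apply/funext => z; rewrite diff_quot_powR.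
  apply: (@measurableT_comp _ _ _ _ _ _ (@powR R ^~ p)) => //.
  by apply: measurableT_comp => //; exact: measurable_diff_quot.
pose g1 k z : R := near_coef p N L k * strips r (2 `^ (- k%:R)) z.
pose g2 k z : R := far_coef p N M k * strips r (2 `^ k.+1%:R) z.
have g10 k z : 0 <= g1 k z by exact: mulr_ge0 (near_coef_ge0 _ _ _ _) (strips_ge0 _ _ _).
have g20 k z : 0 <= g2 k z by exact: mulr_ge0 (far_coef_ge0 _ _ _ _) (strips_ge0 _ _ _).
have mS := measurable_strips r.
have mg1 k : measurable_fun setT (g1 k) by exact: measurable_funM.
have mg2 k : measurable_fun setT (g2 k) by exact: measurable_funM.
pose g k z : \bar R := ((g1 k z)%:E + (g2 k z)%:E)%E.
have g0 k z : (0 <= g k z)%E by rewrite adde_ge0 ?lee_fin.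
have mg k : measurable_fun setT (g k) by apply: emeasurable_funD; exact/measurable_EFinP.
have Gg z : ((G z)%:E <= \sum_(0 <= k <oo) g k z)%E.
  have [Gz|[k Gk]] := quotient_dyadic z p0 (ltW N0) L0 M0 fL fM f0.
    by rewrite [G z]Gz; apply: nneseries_ge0.
  apply: (@le_trans _ _ (\sum_(0 <= i < k.+1) g i z)%E); last exact: nneseries_lim_ge.
  rewrite big_nat_recr//= -[leLHS]add0e leeD ?sume_ge0//.
  rewrite /g -EFinD lee_fin; case: Gk => Gk; apply: (le_trans Gk).
    by rewrite lerDl.
  by rewrite lerDr.
have msum : measurable_fun setT (fun z => \sum_(0 <= k <oo) g k z)%E.
  by apply: ge0_emeasurable_sum => //.
have sum0 z : (0 <= \sum_(0 <= k <oo) g k z)%E by apply: nneseries_ge0.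
rewrite /gagliardo; apply: poweR_lty.
apply: (@le_lt_trans _ _
  (\int[(leb n \x leb n)%E]_(z in Omega `*` Omega) (\sum_(0 <= k <oo) g k z))%E).
  apply: ge0_le_integral => //.
  - exact: measurableX.
  - by move=> z _; rewrite lee_fin mulr_ge0 ?invr_ge0 ?powR_ge0.
  - exact: measurable_funTS.
  - by move=> z _; exact: Gg.
apply: (@le_lt_trans _ _ (\int[(leb n \x leb n)%E]_z (\sum_(0 <= k <oo) g k z))%E).
  by apply: ge0_subset_integral => //; exact: measurableX.
rewrite integral_nneseries//.
have intg k : (\int[(leb n \x leb n)%E]_z g k z =
   (near_coef p N L k * (((2 `^ (- k%:R) *+ 2) ^+ n * (r *+ 2) ^+ n) *+ 2) +
    far_coef p N M k * (((2 `^ k.+1%:R *+ 2) ^+ n * (r *+ 2) ^+ n) *+ 2))%:E)%E.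
  rewrite ge0_integralD//; last 4 first.
  - by move=> z _; rewrite lee_fin.
  - exact/measurable_EFinP.
  - by move=> z _; rewrite lee_fin.
  - exact/measurable_EFinP.
  under eq_integral do rewrite EFinM.
  under [X in (_ + X)%E]eq_integral do rewrite EFinM.
  rewrite !ge0_integralZl_EFin ?near_coef_ge0 ?far_coef_ge0//; last 4 first.
  - by move=> z _; rewrite lee_fin strips_ge0.
  - exact/measurable_EFinP.
  - by move=> z _; rewrite lee_fin strips_ge0.
  - exact/measurable_EFinP.
  by rewrite !integral_strips ?powR_ge0// -!EFinM -EFinD.
have X0 : 0 <= (2 : R) ^+ n * (r *+ 2) ^+ n *+ 2.
  by rewrite mulrn_wge0// mulr_ge0 ?exprn_ge0// mulrn_wge0.
apply: (@nneseries_geometric_lty R _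
  (L `^ p * 2 `^ N * ((2 : R) ^+ n * (r *+ 2) ^+ n *+ 2))
  ((M *+ 2) `^ p * 2 `^ n%:R * ((2 : R) ^+ n * (r *+ 2) ^+ n *+ 2))
  (2 `^ (- ((1 - theta) * p))) (2 `^ (- (theta * p)))).
- exact: powR_ge0.
- by apply: powR2_lt1; rewrite mulr_gt0// subr_gt0.
- exact: powR_ge0.
- by apply: powR2_lt1; rewrite mulr_gt0.
- by apply: mulr_ge0 X0; rewrite mulr_ge0 ?powR_ge0.
- by apply: mulr_ge0 X0; rewrite mulr_ge0 ?powR_ge0.
- by move=> k; apply: integral_ge0 => z _.
- by move=> k; rewrite intg near_coef_volume// far_coef_volume.
Qed.

Lemma gagliardo_testfun_lty theta (p : R) (phi : testfun Omega) : 1 <= p ->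
  0 < theta -> theta < 1 -> (gagliardo Omega theta p (phi : E -> R) < +oo)%E.
Proof.
move=> p1 th0 th1.
have [L L0 HL] := testfun_lipschitz phi; have [M M0 HM] := testfun_bounded phi.
have [r r0 Hr] := testfun_cbox phi.
apply: (@gagliardo_lty _ theta p L M r) => //.
by apply: measurable_funTS; exact: measurable_testfun.
Qed.

End gagliardo_finite.

(** * Test functions in Sobolev spaces *)

Section testfun_in_sobolev.
Context {R : realType} {n : nat} {Omega : set 'rV[R]_n}.
Local Notation E := 'rV[R]_n.
Hypothesis mO : measurable Omega.
Implicit Types phi psi : testfun Omega.
Local Notation dist_of := (@dist_of R n Omega).

Lemma sobolev_norm_ge0_testfun_lty s p phi : 0 <= s -> 1 < p ->
  (sobolev_norm_ge0 s p (dist_of phi) < +oo)%E.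
Proof.
move=> s0 p1; have p0 : 0 < p by exact: lt_trans p1.
have /andP[ks sk] := Num.Theory.trunc_itv s0.
have repr k (nu : midx n k) : Lp_repr p (dpartial nu (dist_of phi))
    (partials_testfun (rev (midx_seq nu)) phi : E -> R).
  by split; [exact: Lp_testfun|exact: dpartial_testfun].
rewrite /sobolev_norm_ge0; apply: lte_add_pinfty.
  apply: lte_sum_pinfty => nu _.
  apply: (@le_lt_trans _ _ (Lp_norm Omega p (partials_testfun (rev (midx_seq nu)) phi :
      E -> R))).
    by apply: ereal_inf_lbound; exists (partials_testfun (rev (midx_seq nu)) phi : E -> R).
  exact: (repr _ nu).1.2.
set theta := s - _; have [//|th0] := eqVneq theta 0.
apply: lte_sum_pinfty => nu _.
apply: (@le_lt_trans _ _ (gagliardo Omega theta p (partials_testfun (rev (midx_seq nu))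
  phi : E -> R))).
  by apply: ereal_inf_lbound; exists (partials_testfun (rev (midx_seq nu)) phi : E -> R).
apply: gagliardo_testfun_lty => //; first exact: ltW.
  by rewrite lt_neqAle eq_sym th0 subr_ge0.
by rewrite ltrBlDl -natr1 in sk *.
Qed.

Lemma sobolev0_testfun s p phi : 0 <= s -> 1 < p -> sobolev0 s p (dist_of phi).
Proof.
move=> s0 p1; split.
  by split; [exact: distributions_testfun|exact: sobolev_norm_ge0_testfun_lty].
move=> e e0; exists phi.
by rewrite subrr (ext_seminorm0 (ext_seminorm_sobolev_ge0 mO s p1)) lte_fin.
Qed.

Lemma testfun_le_dLp_norm p phi : 1 < p -> exists2 c : R, 0 < c &
  forall v : functional Omega, (`|v phi|%:E <= c%:E * dLp_norm p v)%E.
Proof.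
move=> p1; set C := ('N[leb n]_((conj_exp p)%:E)[EFin \o (phi : E -> R)])%E.
have Cfin : C \is a fin_num.
  rewrite ge0_fin_numE ?Lnorm_ge0//; apply: Lnorm_testfun_lty.
  exact: lt_trans (conj_exp_gt1 p1).
have C0 : 0 <= fine C by rewrite fine_ge0// Lnorm_ge0.
(* adding 1 makes the constant positive, so that one can divide by it *)
have c0 : 0 < fine C + 1 by rewrite ltr_wpDl.
exists (fine C + 1) => // v; rewrite -lee_pdivrMl//.
apply: le_ereal_inf_tmp => _ [f [Lf ->] <-].
rewrite lee_pdivrMl// (le_trans (dist_of_le mO phi p1 Lf))// muleC.
by rewrite lee_wpmul2r ?Lnorm_ge0// -/C -[leLHS]fineK// lee_fin lerDl.
Qed.

(** For [s < 0], normalizing [phi] in W^{-s,p'} gives an element of the unit ball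
    over which the dual norm is a supremum. *)
Lemma testfun_le_sobolev_norm s p phi : 1 < p -> exists2 c : R, 0 < c &
  forall v : functional Omega, linear v -> (`|v phi|%:E <= c%:E * sobolev_norm s p v)%E.
Proof.
move=> p1; rewrite /sobolev_norm; have [s0|s0] := leP 0 s.
  have [c c0 Hc] := testfun_le_dLp_norm phi p1; exists c => // v _.
  apply: le_trans (Hc v) _; rewrite lee_wpmul2l ?lee_fin ?(ltW c0)//.
  rewrite /sobolev_norm_ge0; set k := Num.trunc s.
  pose nu0 : midx n k := [ffun=> ord0].
  have onu0 : ord nu0 = 0%N by rewrite /ord big1// => i _; rewrite ffunE.
  have Dv : dpartial nu0 v = v.
    apply/funext => psi; rewrite /dpartial onu0 expr0 mul1r; congr v; apply: val_inj => /=.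
    by have /size0nil -> : size (midx_seq nu0) = 0%N by rewrite size_midx_seq.
  have es := ext_seminorm_dLp_norm mO p1.
  rewrite (bigD1 nu0)/= ?onu0// Dv -addeA leeDl// adde_ge0//.
    by rewrite sume_ge0// => nu _; exact: (es_ge0 es).
  case: ifP => // _; rewrite sume_ge0// => nu _.
  exact: (es_ge0 (ext_seminorm_dgagliardo mO _ p1)).
have s0' : 0 <= - s by rewrite oppr_ge0 ltW.
have q1 := conj_exp_gt1 p1; have es := ext_seminorm_sobolev_ge0 mO (- s) q1.
set N := sobolev_norm_ge0 (- s) (conj_exp p) (dist_of phi).
have Nfin : N \is a fin_num.
  by rewrite ge0_fin_numE ?(es_ge0 es)//; exact: sobolev_norm_ge0_testfun_lty.
have N0 : 0 <= fine N by rewrite fine_ge0// (es_ge0 es).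
have c0 : 0 < fine N + 1 by rewrite ltr_wpDl.
exists (fine N + 1) => // v lv; rewrite -lee_pdivrMl//.
apply: le_ereal_inf_tmp => _ [F [_ Fv] <-].
set c := fine N + 1 in c0 *.
have -> : ((c^-1)%:E * `|v phi|%:E = `|F (dist_of (c^-1 *: phi))|%:E)%E.
  rewrite Fv -EFinM; have -> : v (c^-1 *: phi) = c^-1 *: v phi.
    have v0 : v 0 = 0 by have := lv (-1) 0 0; rewrite scaler0 addr0 scaleN1r addNr.
    by have := lv c^-1 phi 0; rewrite addr0 v0 addr0.
  by rewrite normrZ gtr0_norm// invr_gt0.
apply: ereal_sup_ubound; exists (dist_of (c^-1 *: phi)) => //; split.
  exact: sobolev0_testfun.
rewrite dist_of_testfunZ// (ext_seminormZ _ _ es) gtr0_norm ?invr_gt0//.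
by rewrite lee_pdivrMl// mule1 -/N -[leLHS]fineK// lee_fin lerDl.
Qed.

Lemma sobolev_norm_eq0 s p (v : functional Omega) : 1 < p -> linear v ->
  sobolev_norm s p v = 0%E -> v = 0.
Proof.
move=> p1 lv v0; apply/funext => phi; have [c _ /(_ v lv)] := testfun_le_sobolev_norm s
  phi p1.
by rewrite v0 mule0 lee_fin normr_le0 => /eqP.
Qed.

End testfun_in_sobolev.

(** * Linear combinations of distributions *)

Section distributions_closed.
Context {R : realType} {n : nat} {Omega : set 'rV[R]_n}.
Local Notation E := 'rV[R]_n.

Lemma linear_add (u v : functional Omega) : linear u -> linear v -> linear (u + v).
Proof. by move=> lu lv a x y; rewrite !fctE lu lv scalerDr addrACA. Qed.

(** Multi-indices with entries at most [N] embed into those with entries at most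
    [N'], with the same order and the same derivatives. *)
Lemma sup_partials_le (f : E -> R) N N' : (N <= N')%N ->
  \sum_(nu : midx n N | (ord nu <= N)%N) sup (range (fun x =>
      `|partials (midx_seq nu) f x|)) <=
  \sum_(nu : midx n N' | (ord nu <= N')%N) sup (range (fun x =>
      `|partials (midx_seq nu) f x|)).
Proof.
move=> NN'; have NN1 : (N.+1 <= N'.+1)%N by [].
pose w (nu : midx n N) : midx n N' := [ffun i => widen_ord NN1 (nu i)].
have wi : injective w.
  move=> nu1 nu2 /ffunP e; apply/ffunP => i; have := e i;
      rewrite !ffunE => /(congr1 val)/= h.
  exact: val_inj.
have ow nu : ord (w nu) = ord nu by apply: eq_bigr => i _; rewrite ffunE.
have sw nu : midx_seq (w nu) = midx_seq nu.
  by rewrite /midx_seq; congr flatten; apply: eq_map => i; rewrite ffunE.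
rewrite [leRHS](bigID (fun nu' => nu' \in w @: [pred nu : midx n N | (ord nu <= N)%N]))/=.
rewrite -[leLHS]addr0 lerD//; last by apply: sumr_ge0 => nu _; exact: sup_norm_ge0.
rewrite (eq_bigl (fun nu' => nu' \in w @: [pred nu : midx n N | (ord nu <= N)%N]));
  last first.
  move=> nu'; rewrite andb_idl// => /imsetP[nu]; rewrite inE => nuN ->.
  by rewrite ow (leq_trans nuN).
rewrite big_imset/=; last by move=> ? ? _ _; exact: wi.
by rewrite le_eqVlt; apply/orP; left; apply/eqP; apply: eq_bigr => nu _; rewrite sw.
Qed.

Lemma distributionsD (u v : functional Omega) :
  distributions u -> distributions v -> distributions (u + v).
Proof.
move=> [lu Hu] [lv Hv]; split; first exact: linear_add.
move=> K cK KO; have [C1 [N1 H1]] := Hu K cK KO; have [C2 [N2 H2]] := Hv K cK KO.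
exists (`|C1| + `|C2|), (maxn N1 N2) => phi sphi.
rewrite fctE (le_trans (ler_normD _ _))// mulrDl.
have upgrade C N N' : (N <= N')%N ->
    C * \sum_(nu : midx n N | (ord nu <= N)%N) sup (range (fun x =>
        `|partials (midx_seq nu) phi x|)) <=
    `|C| * \sum_(nu : midx n N' | (ord nu <= N')%N) sup (range (fun x =>
        `|partials (midx_seq nu) phi x|)).
  move=> NN'; apply: (le_trans (ler_wpM2r _ (ler_norm C))).
    by apply: sumr_ge0 => nu _; exact: sup_norm_ge0.
  by rewrite ler_wpM2l// sup_partials_le.
apply: lerD.
  by apply: (le_trans (H1 phi sphi)); apply: upgrade; exact: leq_maxl.
by apply: (le_trans (H2 phi sphi)); apply: upgrade; exact: leq_maxr.
Qed.

Lemma distributionsZ a (u : functional Omega) : distributions u -> distributions (a *: u).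
Proof.
move=> [lu Hu]; split.
  by move=> b x y; rewrite -[LHS]/(a *: u (b *: x + y)) lu scalerDr !scalerA mulrC.
move=> K cK KO; have [C [N H]] := Hu K cK KO; exists (`|a| * C), N => phi sphi.
by rewrite -[X in `|X|]/(a * u phi) normrM -mulrA ler_wpM2l// H.
Qed.

End distributions_closed.

(** * Comparison of natural topologies *)

Section topology_comparison.
Context {R : realType} {V : lmodType R}.
Implicit Types (X : set V) (P Q : set (V -> R)).

Lemma topology_locally_open X (O : set (set V)) (U : set V) : topology_on X O ->
  (forall x, U x -> exists2 W, O W & W x /\ W `<=` U) -> O U.
Proof.
move=> [_ _ cupO _] HU.
rewrite (_ : U = \bigcup_(W in [set W | O W /\ W `<=` U]) W); first by apply: cupO => W [].
apply/seteqP; split=> x; last by move=> [W [_ WU]]; exact: WU.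
by move=> /HU[W OW [Wx WU]]; exists W.
Qed.

Lemma topology_seminorm_balls X (O : set (set V)) (s : seq (V -> R)) (d : R) :
  topology_on X O -> (forall q, q \in s -> continuous_for X O q) ->
  O [set y | X y /\ forall q, q \in s -> q y < d].
Proof.
move=> [OX _ _ OI]; elim: s => [|q s IH] sO.
  by rewrite (_ : [set y | _] = X)//; apply/seteqP; split=> y // [].
rewrite (_ : [set y | _] =
  (X `&` q @^-1` [set t | t < d]) `&` [set y | X y /\ forall q', q' \in s -> q' y < d]).
  apply: OI; last by apply: IH => q' q's; apply: sO; rewrite in_cons q's orbT.
  by apply: sO; [rewrite mem_head|exact: open_lt].
apply/seteqP; split=> y.
  move=> [Xy h]; split; split=> //; first by apply: h; rewrite mem_head.
  by move=> q' q's; apply: h; rewrite in_cons q's orbT.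
by move=> [[Xy qy] [_ h]]; split=> // q'; rewrite in_cons => /orP[/eqP->|]; [|exact: h].
Qed.

Lemma seminorm_on0 X q : X 0 -> seminorm_on X q -> q 0 = 0.
Proof. by move=> X0 [_ /(_ 0 0 X0) h _]; rewrite scale0r normr0 mul0r in h. Qed.

(** By translation invariance, [x + {y | r y < d for all r in s}] is open, and it is
    mapped by [q] close to [q x] because [|q (x + y) - q x| <= q y]. *)
Lemma dominated_continuous X (O : set (set V)) (q : V -> R) (s : seq (V -> R)) (C : R) :
  X 0 -> (forall a x y, X x -> X y -> X (a *: x + y)) ->
  topology_on X O -> translation_invariant X O ->
  seminorm_on X q -> (forall r, r \in s -> seminorm_on X r /\ continuous_for X O r) ->
  (forall x, X x -> q x <= C * \sum_(r <- s) r x) ->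
  continuous_for X O q.
Proof.
move=> X0 XL tO trO sq sO qC D oD; apply: (topology_locally_open tO) => x [Xx Dqx].
have XD y z : X y -> X z -> X (y + z)
  by move=> Xy Xz; have := XL 1 y z Xy Xz; rewrite scale1r.
have XN y : X y -> X (- y) by move=> Xy; have := XL (-1) y 0 Xy X0; rewrite scaleN1r addr0.
have /nbhs_ballP[e /= e0 eD] : nbhs (q x) D by exact: open_nbhs_nbhs.
(* the radius [d] is chosen so that [C * (size s * d) < e], also when [C = 0] *)
pose m := `|C| * (size s)%:R + 1; have m0 : 0 < m by rewrite ltr_wpDl// mulr_ge0.
pose d := e / m; have d0 : 0 < d by rewrite divr_gt0.
exists [set x + y | y in [set y | X y /\ forall r, r \in s -> r y < d]].
  by apply: trO => //; apply: (topology_seminorm_balls _ tO) => r /sO[].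
split.
  exists 0; last by rewrite addr0.
  by split=> // r /sO[sr _]; rewrite (seminorm_on0 X0 sr).
move=> _ [y [Xy yd] <-]; split; first exact: XD.
have [_ qZ qD] := sq.
have qy : q y < e.
  apply: le_lt_trans (qC _ Xy) _; apply: (@le_lt_trans _ _ (`|C| * ((size s)%:R * d))).
    have s0 : 0 <= \sum_(r <- s) r y.
      by rewrite big_seq sumr_ge0// => r /sO[[r0 _ _] _]; exact: r0.
    apply: le_trans (ler_wpM2r s0 (ler_norm C)) _; rewrite ler_wpM2l//.
    apply: (@le_trans _ _ (\sum_(r <- s) d)).
      by rewrite big_seq [leRHS]big_seq; apply: ler_sum => r rs; exact: ltW (yd _ rs).
    by rewrite big_const_seq count_predT iter_addr_0 mulr_natl.
  by rewrite mulrA /d mulrA ltr_pdivrMr// mulrC ltr_pM2l// /m ltrDl.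
apply: eD; rewrite /ball/= ltr_norml; apply/andP; split.
  by have := qD _ _ Xx Xy; lra.
have qNy : q (- y) = q y by rewrite -scaleN1r qZ// normrN1 mul1r.
have := qD _ _ (XD _ _ Xx Xy) (XN _ Xy); rewrite addrK qNy; lra.
Qed.

(** The seminorms of [P] and those of [Q] are continuous for the same translation
    invariant topologies, so the two intersections are over the same set. *)
Lemma natural_topology_dominated X P Q : X 0 ->
  (forall a x y, X x -> X y -> X (a *: x + y)) ->
  P `<=` Q -> (forall q, Q q -> seminorm_on X q) ->
  (forall q, Q q -> exists (s : seq (V -> R)) (C : R), (forall r, r \in s -> P r) /\
     forall x, X x -> q x <= C * \sum_(r <- s) r x) ->
  natural_topology X P = natural_topology X Q.
Proof.
move=> X0 XL PQ Qsn dom; rewrite /natural_topology; congr (bigcap _ _).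
apply/seteqP; split=> O [tO trO cO]; split=> // q.
  move=> Qq; have [s [C [sP qC]]] := dom q Qq.
  apply: (dominated_continuous X0 XL tO trO (Qsn _ Qq) _ qC) => r rs.
  by split; [exact/Qsn/PQ/sP|exact/cO/sP].
by move=> /PQ; exact: cO.
Qed.

End topology_comparison.

(** * Division of test functions *)

Section quotient_smooth.
Context {R : realType} {n : nat}.
Local Notation E := 'rV[R]_n.

(** The functions [f1 / g1], with [supp f1] inside [supp f] and [g1] nonzero on
    [supp f], are stable under differentiation: on [supp f] by the quotient rule,
    and off [supp f] because they vanish near such points. *)
Lemma smooth_quotient (f g : E -> R) : smooth f -> smooth g ->
  (forall x, supp f x -> g x != 0) -> smooth (f * (fun x => (g x)^-1)).
Proof.
move=> sf sg gf.
pose S : set (E -> R) := [set h | exists f1 g1, [/\ smooth f1, smooth g1,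
  supp f1 `<=` supp f, (forall x, supp f x -> g1 x != 0) & h = f1 * (fun x => (g1 x)^-1)]].
have near0 f1 g1 x : supp f1 `<=` supp f -> ~ supp f x ->
    \forall y \near x, cst 0 y = (f1 * (fun x => (g1 x)^-1)) y.
  move=> sub nx; have : nbhs x (~` supp f).
    by apply: open_nbhs_nbhs; split=> //; exact/closed_openC/closed_closure.
  by apply: filterS => y /= ny; rewrite fctE (@supp_out _ _ f1) ?mul0r// => /sub.
have dS h x i : S h -> derivable h x (delta_mx ord0 i).
  move=> [f1 [g1 [sf1 sg1 sub g10 ->]]]; have [fx|nfx] := pselect (supp f x).
    apply: derivableM; first exact: (sf1 [::]).2.
    by apply: derivableV; [exact: g10|exact: (sg1 [::]).2].
  by apply: near_eq_derivable (near0 _ _ _ sub nfx) _; exact: derivable_cst.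
apply: (@smooth_ind _ _ S); last by exists f, g; split.
- move=> h [f1 [g1 [sf1 sg1 sub g10 ->]]] x; have [fx|nfx] := pselect (supp f x).
    apply: continuousM; first exact: (sf1 [::]).1.
    by apply: continuousV; [exact: g10|exact: (sg1 [::]).1].
  have n0 := near0 _ g1 _ sub nfx.
  rewrite /continuous_at -(nbhs_singleton n0); apply: cvg_trans (near_eq_cvg n0) _.
  exact: cvg_cst.
- by move=> h x i; exact: dS.
move=> h i [f1 [g1 [sf1 sg1 sub g10 ->]]].
have smf (k : E -> R) : smooth k -> smooth (partial i k) by exact: (smooth_partials [:: i]).
exists (g1 * partial i f1 + cst (-1) * (f1 * partial i g1)), (g1 * g1).
have sub' : supp (partial i f1) `<=` supp f by apply: subset_trans sub; exact: partial_supp.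
split.
- exact: smoothD (smoothM sg1 (smf _ sf1)) (smoothM (@smooth_cst _ _ (-1)) (smoothM sf1
  (smf _ sg1))).
- exact: smoothM.
- apply: subset_trans (@suppD _ _ _ _) _ => x [/suppMr/sub'//|/suppMr/suppMl/sub//].
- by move=> x fx; rewrite fctE mulf_neq0 ?g10.
apply/funext => x; have [fx|nfx] := pselect (supp f x).
  have gx := g10 x fx; pose e : E := delta_mx ord0 i.
  have df : derivable f1 x e := (sf1 [::]).2 x i.
  have dg : derivable g1 x e := (sg1 [::]).2 x i.
  have dV : derivable (fun y => (g1 y)^-1) x e := derivableV gx dg.
  have EV : 'D_e (fun y => (g1 y)^-1) x = - (g1 x) ^- 2 * partial i g1 x := deriveV gx dg.
  rewrite [LHS](deriveM df dV) EV.
  rewrite -[LHS]/(f1 x * (- (g1 x) ^- 2 * partial i g1 x) + (g1 x)^-1 * partial i f1 x).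
  rewrite -[RHS]/((g1 x * partial i f1 x + -1 * (f1 x * partial i g1 x)) * (g1 x * g1
      x)^-1).
  by field.
have f1x : f1 x = 0 by apply: supp_out => /sub.
have df1x : partial i f1 x = 0 by apply: supp_out => /sub'.
rewrite [LHS]/partial -(near_eq_derive _ (near0 _ g1 _ sub nfx)) derive_cst.
rewrite -[RHS]/((g1 x * partial i f1 x + -1 * (f1 x * partial i g1 x)) * (g1 x * g1 x)^-1).
by rewrite f1x df1x !(mulr0, mul0r, addr0).
Qed.

End quotient_smooth.

(** * Factorization through an admissible family *)

Section factorization.
Context {R : realType} {n : nat} {Omega : set 'rV[R]_n}.
Local Notation E := 'rV[R]_n.
Implicit Types phi psi eta : testfun Omega.
Local Notation dist_of := (@dist_of R n Omega).

Lemma testfun_sumE (s : seq (testfun Omega)) (x : E) :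
  (\sum_(psi <- s) psi) x = \sum_(psi <- s) psi x.
Proof.
by apply: (big_morph (fun psi : testfun Omega => psi x)).
Qed.

(** By compactness, finitely many nonnegative members of [A] have a sum that is
    positive on [supp phi]; [eta] is [phi] divided by this sum. *)
Lemma admissible_factorization (A : set (testfun Omega)) phi : admissible_family A ->
  exists (s : seq (testfun Omega)) eta, (forall psi, psi \in s -> A psi) /\
    phi = \sum_(psi <- s) mul_testfun psi eta.
Proof.
move=> adA.
pose D : set (testfun Omega) := [set psi | A psi /\ forall y, 0 <= psi y].
pose U psi : set E := [set x | psi x != 0].
have := @compact_supp _ _ _ phi; rewrite compact_cover => /(_ _ D U) [psi _||D' sD' cD'].
- rewrite (_ : U psi = (psi : E -> R) @^-1` [set t | t != 0])//.
  by apply: open_comp; [move=> x _; exact: testfun_continuous|exact: open_neq].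
- by move=> x /supp_sub/adA[psi Apsi [psi0 psix]]; exists psi.
pose s : seq (testfun Omega) := finmap.enum_fset D'.
have sA psi : psi \in s -> A psi /\ forall y, 0 <= psi y.
  by move=> h; have := sD' psi h; rewrite inE.
pose g : E -> R := \sum_(psi <- s) psi : testfun Omega.
have g0 x : supp phi x -> g x != 0.
  move=> /cD'[psi /= psis psix]; rewrite /g testfun_sumE gt_eqF//.
  have psi0 : 0 < psi x by rewrite lt_neqAle eq_sym psix (sA psi psis).2.
  rewrite (big_rem psi)//= ltr_wpDr// big_seq sumr_ge0// => chi /mem_rem chis.
  exact: (sA chi chis).2.
have etaP : (phi : E -> R) * (fun x => (g x)^-1) \in Cc_smooth Omega.
  apply: Cc_smooth_sub (testfun_in phi); last exact: suppMl.
  by apply: smooth_quotient => //; exact: testfun_smooth.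
exists s, (TestFun etaP); split; first by move=> psi /sA[].
apply: val_inj; apply/funext => x /=.
rewrite [RHS](_ : _ = (\sum_(psi <- s) mul_testfun psi (TestFun etaP)) x)//.
rewrite (big_morph (fun psi : testfun Omega => psi x) (id1 := 0) (op1 := +%R))//.
under eq_bigr => psi _ do rewrite [_ x](_ : _ = psi x * (phi x * (g x)^-1))//.
rewrite -mulr_suml -testfun_sumE -/(g x).
have [/g0 gx|/supp_out ->] := pselect (supp phi x); last by rewrite mul0r mulr0.
by rewrite mulrC divfK.
Qed.

Lemma linear_sum_testfun (u : functional Omega) (s : seq (testfun Omega)) (F :
  testfun Omega -> testfun Omega) :
  linear u -> u (\sum_(psi <- s) F psi) = \sum_(psi <- s) u (F psi).
Proof.
move=> lu; apply: (big_morph u) => [x y|].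
  by have := lu 1 x y; rewrite !scale1r.
by have := lu (-1) 0 0; rewrite scaler0 addr0 scaleN1r addNr.
Qed.

Lemma dmul_factorization (u : functional Omega) (s : seq (testfun Omega)) eta : linear u ->
  dmul (\sum_(psi <- s) mul_testfun psi eta) u = \sum_(psi <- s) dmul eta (dmul psi u).
Proof.
move=> lu; apply/funext => chi; rewrite fct_sumE /dmul -linear_sum_testfun//; congr u.
apply: val_inj; apply/funext => x /=.
rewrite -[LHS]/((\sum_(psi <- s) mul_testfun psi eta) x * chi x).
rewrite -[RHS]/((\sum_(psi <- s) mul_testfun psi (mul_testfun eta chi)) x).
rewrite !(big_morph (fun psi : testfun Omega => psi x) (id1 := 0) (op1 := +%R))//.
by rewrite mulr_suml; apply: eq_bigr => psi _;
  rewrite -[LHS]/(psi x * eta x * chi x) -mulrA.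
Qed.

Lemma dmul_linear phi : linear (@dmul _ _ Omega phi).
Proof. by []. Qed.

Lemma dsupp_dmul (psi : testfun Omega) (u : functional Omega) : open Omega -> linear u ->
  dsupp (dmul psi u) `<=` supp psi.
Proof.
move=> oO lu x [Ox Hx]; apply: contrapT => nx.
have u0 : u 0 = 0 by have := lu (-1) 0 0; rewrite scaler0 addr0 scaleN1r addNr.
have [||//|chi schi] := Hx (Omega `&` ~` supp psi).
- by apply: openI => //; exact/closed_openC/closed_closure.
- by move=> y [].
rewrite /dmul (_ : mul_testfun psi chi = 0) ?u0 ?eqxx//.
apply: val_inj; apply/funext => y /=.
have [py|npy] := pselect (supp psi y); last by rewrite fctE (supp_out npy) mul0r.
by rewrite fctE (@supp_out _ _ chi y) ?mulr0// => /schi[].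
Qed.

End factorization.

(** * Local Sobolev spaces *)

Section local_sobolev.
Context {R : realType} {n : nat} {Omega : set 'rV[R]_n}.
Local Notation E := 'rV[R]_n.
Hypothesis oO : open Omega.
Variables (s p : R).
Hypothesis p1 : 1 < p.
Implicit Types phi psi eta : testfun Omega.

Let mO : measurable Omega := open_measurable_rV oO.
Let es := @ext_seminorm_sobolev _ _ _ mO s p p1.

Lemma sobolev_0 : sobolev s p (0 : functional Omega).
Proof. by split; [exact: distributions0|rewrite (ext_seminorm0 es)]. Qed.

Lemma sobolevD (u v : functional Omega) : sobolev s p u -> sobolev s p v ->
  sobolev s p (u + v).
Proof.
move=> [du nu] [dv nv]; split; first exact: distributionsD.
by apply: le_lt_trans (es_add es _ _) _ => //; exact: lte_add_pinfty.
Qed.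

Lemma sobolevZ a (u : functional Omega) : sobolev s p u -> sobolev s p (a *: u).
Proof.
move=> [du nu]; split; first exact: distributionsZ.
by rewrite (ext_seminormZ _ _ es) lte_mul_pinfty.
Qed.

Lemma sobolev_sum (l : seq (testfun Omega)) (F : testfun Omega -> functional Omega) :
  (forall psi, psi \in l -> sobolev s p (F psi)) -> sobolev s p (\sum_(psi <- l) F psi).
Proof.
move=> H; rewrite big_seq; apply: big_ind => //; [exact: sobolev_0|exact: sobolevD].
Qed.

Lemma sobolev_norm_sum (l : seq (testfun Omega)) (F : testfun Omega -> functional Omega) :
  (sobolev_norm s p (\sum_(psi <- l) F psi)%R <=
      \sum_(psi <- l) sobolev_norm s p (F psi))%E.
Proof.
elim: l => [|psi l IH]; first by rewrite !big_nil (ext_seminorm0 es).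
by rewrite !big_cons (le_trans (es_add es _ _))// leeD2l.
Qed.

Lemma sobolev_norm_fin (u : functional Omega) : sobolev s p u ->
  sobolev_norm s p u \is a fin_num.
Proof. by move=> [_ h]; rewrite ge0_fin_numE// (es_ge0 es). Qed.

Lemma loc_seminorm_on phi : seminorm_on (sobolev_loc (Omega := Omega) s p)
  (loc_seminorm s p phi).
Proof.
have fn u : sobolev_loc s p u -> sobolev_norm s p (dmul phi u) \is a fin_num.
  by move=> [_ h]; exact: sobolev_norm_fin.
split=> [u _|a u uX|u v uX vX]; rewrite /loc_seminorm.
- by rewrite fine_ge0// (es_ge0 es).
- by rewrite -[dmul phi (a *: u)]/(a *: dmul phi u) (ext_seminormZ _ _ es) fineM ?fn.
- rewrite -[dmul phi (u + v)]/(dmul phi u + dmul phi v) -fineD ?fn//.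
  apply: fine_le; last exact: (es_add es).
  + by apply: sobolev_norm_fin; apply: sobolevD; [exact: uX.2|exact: vX.2].
  + by rewrite fin_numD !fn.
Qed.

Lemma sobolev_loc_0 : sobolev_loc s p (0 : functional Omega).
Proof. by split; [exact: distributions0|move=> phi; exact: sobolev_0]. Qed.

Lemma sobolev_locL a (u v : functional Omega) :
  sobolev_loc s p u -> sobolev_loc s p v -> sobolev_loc s p (a *: u + v).
Proof.
move=> [du hu] [dv hv]; split; first by apply: distributionsD => //; exact: distributionsZ.
move=> phi; rewrite dmul_linear; apply: sobolevD => //; exact: sobolevZ.
Qed.

Hypothesis ism : interior_smooth_multiplication_triple Omega s p.

(** The distribution [psi u] has its support in the compact set [supp psi], so that
    multiplying it by [eta] is a bounded operation. *)
Lemma dmul_bounded eta (l : seq (testfun Omega)) : exists2 C : R, 0 <= C &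
  forall psi (u : functional Omega), psi \in l -> distributions u ->
    sobolev s p (dmul psi u) ->
    sobolev s p (dmul eta (dmul psi u)) /\
    (sobolev_norm s p (dmul eta (dmul psi u)) <= C%:E * sobolev_norm s p (dmul psi u))%E.
Proof.
have H psi := ism eta (@compact_supp _ _ _ psi) (@supp_sub _ _ _ psi).
have [C HC] := choice H; exists (\sum_(psi <- l) `|C psi|); first exact: sumr_ge0.
move=> psi u psil [lu _] su.
have [[sv _] vC] := HC psi (dmul psi u) (conj su (dsupp_dmul oO lu)).
split => //; apply: le_trans vC _; rewrite lee_wpmul2r ?(es_ge0 es)// lee_fin.
by rewrite (le_trans (ler_norm _))// (big_rem psi)//= lerDl sumr_ge0.
Qed.

Variable A : set (testfun Omega).
Hypothesis adA : admissible_family A.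

(** [phi u] is the sum of the [eta (psi u)], on each of which [dmul_bounded]
    applies. *)
Lemma sobolev_norm_dominated phi : exists (l : seq (testfun Omega)) (C : R),
  (forall psi, psi \in l -> A psi) /\ 0 <= C /\
  forall u : functional Omega, distributions u ->
    (forall psi, A psi -> sobolev s p (dmul psi u)) ->
    sobolev s p (dmul phi u) /\
    (sobolev_norm s p (dmul phi u) <=
     C%:E * \sum_(psi <- l) sobolev_norm s p (dmul psi u))%E.
Proof.
have [l [eta [lA ->]]] := admissible_factorization phi adA.
have [C C0 HC] := dmul_bounded eta l.
exists l, C; split=> //; split=> // u du su; rewrite dmul_factorization; last exact: du.1.
have HC' psi : psi \in l -> _ := fun psil => HC psi u psil du (su psi (lA psi psil)).
split; first by apply: sobolev_sum => psi /HC'[].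
apply: le_trans (sobolev_norm_sum _ _) _.
rewrite ge0_sume_distrr; last by move=> psi _; exact: (es_ge0 es).
by rewrite big_seq [leRHS]big_seq; apply: lee_sum => psi /HC'[].
Qed.

Lemma sobolev_loc_admissible : sobolev_loc s p =
  [set u : functional Omega | distributions u /\
     forall phi, A phi -> sobolev s p (dmul phi u)].
Proof.
apply/seteqP; split=> [u [du hu]|u [du hu]]; split=> // phi.
have [l [C [_ [_ H]]]] := sobolev_norm_dominated phi.
exact: (H u du hu).1.
Qed.

(** Each [chi] is a sum of products [psi * eta] with [psi] in [A], and [u] vanishes
    on such a product because [psi u] does. *)
Lemma loc_seminorms_separating :
  separating_family (sobolev_loc (Omega := Omega) s p)
    [set loc_seminorm s p phi | phi in A].
Proof.
split=> [_ [phi _ <-]|u [du su]]; first exact: loc_seminorm_on.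
apply: contra_neqP => nq; apply/funext => chi.
have [l [eta [lA ->]]] := admissible_factorization chi adA.
rewrite linear_sum_testfun; last exact: du.1.
rewrite big_seq big1// => psi /lA Apsi.
have -> : u (mul_testfun psi eta) = dmul psi u eta by [].
have [dv nv] := su psi; rewrite (@sobolev_norm_eq0 R n Omega mO s p _ p1 dv.1)//.
have vfin := sobolev_norm_fin (su psi).
apply/eqP; apply: contrapT => /negP N0; apply: nq.
exists (loc_seminorm s p psi); first by exists psi.
by rewrite /loc_seminorm fine_eq0.
Qed.

Lemma loc_topology_admissible :
  natural_topology (sobolev_loc (Omega := Omega) s p)
    [set loc_seminorm s p phi | phi in A] =
  natural_topology (sobolev_loc (Omega := Omega) s p)
    [set loc_seminorm s p phi | phi in [set: testfun Omega]].
Proof.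
apply: natural_topology_dominated.
- exact: sobolev_loc_0.
- by move=> a u v; exact: sobolev_locL.
- by move=> _ [phi _ <-]; exists phi.
- by move=> _ [phi _ <-]; exact: loc_seminorm_on.
move=> _ [phi _ <-]; have [l [C [lA [C0 H]]]] := sobolev_norm_dominated phi.
exists (map (loc_seminorm s p) l), C; split.
  by move=> _ /mapP[psi /lA Apsi ->]; exists psi.
move=> u [du su]; have [sphi le] := H u du (fun psi _ => su psi).
have fn psi := sobolev_norm_fin (su psi).
rewrite big_map /loc_seminorm sum_fine => [|psi _]; last exact: fn.
rewrite -lee_fin EFinM !fineK ?fn//.
by apply/sum_fin_numP => psi _ _; exact: fn.
Qed.

End local_sobolev.

Theorem theorem5p3 (R : realType) (n : nat) (Omega : set 'rV[R]_n) (s p : R)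
    (A : set (testfun Omega)) :
  open Omega -> Omega !=set0 -> 1 < p ->
  interior_smooth_multiplication_triple Omega s p ->
  admissible_family A ->
  [/\ sobolev_loc s p =
        [set u : functional Omega | distributions u /\
           forall phi, A phi -> sobolev s p (dmul phi u)],
      separating_family (sobolev_loc s p)
        [set loc_seminorm s p phi | phi in A] &
      natural_topology (sobolev_loc s p)
        [set loc_seminorm s p phi | phi in A] =
      natural_topology (sobolev_loc s p)
        [set loc_seminorm s p phi | phi in [set: testfun Omega]]].
Proof.
move=> oO _ p1 ism adA; split.
- exact: sobolev_loc_admissible.
- exact: loc_seminorms_separating.
- exact: loc_topology_admissible.
Qed.
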